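(* Let $G$ be a totally disconnected locally compact Polish abelian group such that its Pontryagin dual $\widehat{G}$ is also totally disconnected and locally compact. Then $G$ has a computable t.d.l.c. presentation if and only if $\widehat{G}$ has a computable t.d.l.c. presentation.
   Context: A computable t.d.l.c. presentation of an abelian group $H$ is a sequence $(A_i,\phi_i)_{i\in\mathbb{N}}$ of countable discrete groups $A_i$ and surjective homomorphisms $\phi_i:A_i\to A_{i-1}$ ($i>0$) such that $H$ is topologically isomorphic to the inverse limit $\varprojlim(A_i,\phi_i)$ (the closed subgroup of $\prod_i A_i$ consisting of $g$ with $\phi_i(g(i))=g(i-1)$ for all $i>0$), the groups $A_i$ are uniformly computable as discrete groups (domain $\subseteq\mathbb{N}$, operations computable uniformly in $i$), the maps $\phi_i$ are uniformly computable, each $\ker\phi_i$ is finite, and from $i$ one can compute a strong index (canonical code of a finite set) for $\ker\phi_i$ as a subset of $A_i$. The Pontryagin dual $\widehat{G}$ is the group of continuous homomorphisms $G\to\mathbb{R}/\mathbb{Z}$ with pointwise addition and compact-open topology. *)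

(* Defs.v *)
From HB Require Import structures.
From mathcomp Require Import all_boot all_order all_algebra.
From mathcomp Require Import ring_quotient.
From mathcomp Require Import all_classical all_reals all_analysis.
Set Implicit Arguments.
Unset Strict Implicit.
Unset Printing Implicit Defensive.
Import Order.TTheory GRing.Theory Num.Theory.
Import numFieldNormedType.Exports.

(* Total recursive functions of several variables: the least class containing
   the basic functions and closed under composition, primitive recursion and
   minimization of regular functions. *)
Inductive recursive : forall n, (n.-tuple nat -> nat) -> Prop :=
| recursive_zero n : recursive (fun _ : n.-tuple nat => 0)
| recursive_succ : recursive (fun t : 1.-tuple nat => (thead t).+1)
| recursive_proj n (i : 'I_n) : recursive (fun t => tnth t i)
| recursive_comp m n (f : m.-tuple nat -> nat)
    (g : 'I_m -> n.-tuple nat -> nat) :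
    recursive f -> (forall j, recursive (g j)) ->
    recursive (fun t => f [tuple g j t | j < m])
| recursive_primrec n (f : n.-tuple nat -> nat) (g : n.+2.-tuple nat -> nat) :
    recursive f -> recursive g ->
    recursive (fun t : n.+1.-tuple nat =>
      nat_rect (fun _ => nat) (f [tuple of behead t])
        (fun k r => g [tuple of k :: r :: behead t]) (thead t))
| recursive_min n (f : n.+1.-tuple nat -> nat)
    (f_regular : forall t : n.-tuple nat,
      exists k, f [tuple of k :: t] == 0) :
    recursive f -> recursive (fun t => ex_minn (f_regular t)).

Definition computable1 (f : nat -> nat) :=
  recursive (fun t : 1.-tuple nat => f (nth 0 t 0)).
Definition computable2 (f : nat -> nat -> nat) :=
  recursive (fun t : 2.-tuple nat => f (nth 0 t 0) (nth 0 t 1)).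
Definition computable3 (f : nat -> nat -> nat -> nat) :=
  recursive (fun t : 3.-tuple nat => f (nth 0 t 0) (nth 0 t 1) (nth 0 t 2)).

Local Open Scope classical_set_scope.

(* The finite set with strong (canonical) index u, where u = \sum_n 2 ^ n,
   n ranging over the elements of the set. *)
Definition strong_index_set (u : nat) : set nat := [set n | odd (u %/ 2 ^ n)].

Local Open Scope ring_scope.

Definition homeomorphism (S T : topologicalType) (f : S -> T) :=
  exists g : T -> S, [/\ cancel f g, cancel g f, continuous f & continuous g].

Definition polish (R : realType) (T : topologicalType) :=
  (exists2 D : set T, countable D & dense D) /\
  exists (M : metricType R) (f : T -> M), homeomorphism f /\
    forall F : set_system M, ProperFilter F -> cauchy F -> exists l : M, F --> l.

(* The circle group R/Z with the quotient topology. *)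
Section circle.
Context (R : realType).

Definition integers : {pred R} := [pred x | x \is a Num.int].

Fact integers_zmod_closed : zmod_closed integers.
Proof. by split=> [|x y xZ yZ]; rewrite inE ?rpred0// rpredB. Qed.

HB.instance Definition _ :=
  GRing.isZmodClosed.Build R integers integers_zmod_closed.

Definition circle : Type := quotient_topology (Quotient.quot integers).

HB.instance Definition _ := Topological.on circle.
HB.instance Definition _ := GRing.isZmodule.Build circle
  (@Quotient.addqA R integers) (@Quotient.addqC R integers)
  (@Quotient.add0q R integers) (@Quotient.addNq R integers).

End circle.

Section circle_topology.
Context (R : realType).
Let C := circle R.

Definition circle_pi : R -> circle R := \pi_(Quotient.quot (@integers R))%qT.
Let pi := circle_pi.

Fact piB (x y : R) : pi (x - y) = pi x - pi y.
Proof. by rewrite /pi /circle_pi Quotient.pi_add Quotient.pi_opp. Qed.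

Fact piE (x y : R) : (pi x = pi y) <-> (x - y \in @integers R).
Proof. by rewrite Quotient.idealrBE; split=> [xy|/eqP//]; apply/eqP. Qed.

Fact circle_pi_continuous : continuous pi.
Proof. exact: pi_continuous. Qed.

Fact pi_surj (c : C) : exists x, pi x = c.
Proof. exists (repr (c : Quotient.quot (@integers R))). exact: reprK. Qed.

Fact open_pi (U : set R) : open U -> open (pi @` U : set C).
Proof.
move=> oU. rewrite /open/= /quotient_open.
have -> : \pi_(quotient_topology (Quotient.quot (@integers R)))%qT @^-1` (pi @` U)
  = \bigcup_(z in [set z | z \in @integers R]) ((fun x => x + z) @^-1` U).
  apply/seteqP; split=> [x [u Uu /piE uxZ]|x [z zZ Uxz]].
    by exists (u - x) => //=; rewrite addrC subrK.
  exists (x + z) => //. apply/piE. by rewrite addrAC subrr add0r.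
apply: bigcup_open => z _; apply: open_comp => // x _.
apply: cvgD; [exact: cvg_id|exact: cvg_cst].
Qed.

Fact circle_sub_continuous : continuous (fun x : C * C => x.1 - x.2).
Proof.
move=> [x y]; have [a <-] := pi_surj x; have [b <-] := pi_surj y.
move=> W /=; rewrite -piB => nW.
have := @circle_pi_continuous (a - b) _ nW.
move=> /(@sub_continuous R^o (a, b)) [[P Q]] /= [nP nQ] PQ.
rewrite nbhsE in nP; rewrite nbhsE in nQ.
have [P' [oP' aP'] P'P] := nP; have [Q' [oQ' bQ'] Q'Q] := nQ.
pose P1 : set C := pi @` P'; pose Q1 : set C := pi @` Q'.
have nP1 : nbhs (pi a) P1.
  by apply: open_nbhs_nbhs; split; [exact: open_pi|exists a].
have nQ1 : nbhs (pi b) Q1.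
  by apply: open_nbhs_nbhs; split; [exact: open_pi|exists b].
exists (P1, Q1) => //.
move=> [u v] /= [[p pP' <-] [q qQ' <-]]; rewrite -piB.
by apply: (PQ (p, q)); split; [exact: P'P|exact: Q'Q].
Qed.

HB.instance Definition _ :=
  PreTopologicalNmodule_isTopologicalZmodule.Build (circle R) circle_sub_continuous.
End circle_topology.

Section compact_open_sub.
Context (X : topologicalType) (Y : topologicalZmodType).
Implicit Types f g h : X -> Y.

Lemma continuous_addf f g :
  continuous f -> continuous g -> continuous (f \+ g).
Proof.
move=> cf cg x; apply: (@continuous_comp _ _ _ (fun x => (f x, g x))
  (fun p : Y * Y => p.1 + p.2)); last exact: add_continuous.
by apply: cvg_pair => /=; [exact: cf|exact: cg].
Qed.

Lemma continuous_subf f g :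
  continuous f -> continuous g -> continuous (f \- g).
Proof.
move=> cf cg x; apply: (@continuous_comp _ _ _ (fun x => (f x, g x))
  (fun p : Y * Y => p.1 - p.2)); last exact: sub_continuous.
by apply: cvg_pair => /=; [exact: cf|exact: cg].
Qed.

Lemma nbhs0_sub (U : set Y) : nbhs 0 U -> exists V : set Y,
  [/\ open V, V 0 & forall a b, V a -> V b -> U (a - b)].
Proof.
move=> U0.
have := @sub_continuous Y (0, 0) U; rewrite /= subr0 => /(_ U0).
move=> [[P Q]] /= [nP nQ] PQ.
have : nbhs 0 (P `&` Q) by apply: filterI.
rewrite nbhsE => -[V [oV V0] VPQ]; exists V; split => // a b Va Vb.
by apply: (PQ (a, b)); split => /=; [have [] := VPQ _ Va|have [] := VPQ _ Vb].
Qed.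

Lemma nbhs_subl (y : Y) (U : set Y) : nbhs 0 U -> nbhs y [set z | U (z - y)].
Proof.
move=> U0; have : {for y, continuous (fun z : Y => z - y)}.
  apply: (@continuous_comp _ _ _ (fun v : Y => (v, y)) (fun p => p.1 - p.2)).
    by apply: cvg_pair => /=; [exact: cvg_id|exact: cvg_cst].
  exact: sub_continuous.
by apply; rewrite subrr.
Qed.

Lemma open_subl (y : Y) (U : set Y) : open U -> open [set z | U (z - y)].
Proof.
move=> oU; apply: (@open_comp _ _ (fun z : Y => z - y)) => // z _.
apply: (@continuous_comp _ _ _ (fun v : Y => (v, y)) (fun p => p.1 - p.2)).
  by apply: cvg_pair => /=; [exact: cvg_id|exact: cvg_cst].
exact: sub_continuous.
Qed.

Lemma compact_open_tube h (K : set X) (O : set Y) : continuous h ->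
  compact K -> open O -> h @` K `<=` O ->
  nbhs 0 [set v | forall x, K x -> O (h x + v)].
Proof.
move=> ch cK oO hKO.
move/compact_near_coveringP : (cK) => /(_ Y (nbhs 0)
  (fun v x => O (h x + v))); apply => x Kx.
have : {for (x, 0), continuous (fun p : X * Y => h p.1 + p.2)}.
  apply: (@continuous_comp _ _ _ (fun p : X * Y => (h p.1, p.2))
    (fun p : Y * Y => p.1 + p.2)); last exact: add_continuous.
  apply: cvg_pair => /=; last exact: cvg_snd.
  by apply: (@cvg_comp _ _ _ fst h _ (nbhs x)); [exact: cvg_fst|exact: ch].
by apply; rewrite /= addr0; apply: open_nbhs_nbhs; split => //; apply: hKO; exists x.
Qed.

Lemma compact_open_near f (K : set X) (U : set Y) : continuous f ->
  compact K -> nbhs 0 U ->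
  nbhs (f : {compact-open, X -> Y})
    [set g | forall x, K x -> U (g x - f x)].
Proof.
move=> cf cK /nbhs0_sub[U1 [oU1 U10 U1U]].
have /nbhs0_sub[U2 [oU2 U20 U2U1]] : nbhs 0 U1 by exact: open_nbhs_nbhs.
have nU2 : nbhs 0 U2 by exact: open_nbhs_nbhs.
move/compact_near_coveringP/near_covering_withinP : (cK) => /(_ {compact-open, X -> Y}
  (nbhs (f : {compact-open, X -> Y})) (fun g x => U (g x - f x))); apply => x Kx.
pose C := closure [set z | U2 (f z - f x)].
have fC z : C z -> U1 (f z - f x).
  move=> /(_ [set w | U2 (f w - f z)]) [].
    exact: (cf z _ (nbhs_subl _ nU2)).
  move=> w /= [wx wz].
  by have := U2U1 _ _ wx wz; rewrite opprB addrC subrKA.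
pose O := [set y | U1 (y - f x)].
have nC : nbhs x [set z | U2 (f z - f x)] by exact: (cf x _ (nbhs_subl _ nU2)).
have nO : nbhs (f : {compact-open, X -> Y}) [set g | g @` (K `&` C) `<=` O].
  apply: open_nbhs_nbhs; split.
    apply: compact_open_open; last exact: open_subl.
    by apply: compact_closedI => //; exact: closed_closure.
  by move=> _ [z [_ Cz] <-]; exact: fC.
exists ([set z | U2 (f z - f x)], [set g | g @` (K `&` C) `<=` O]) => //=.
move=> [z g] /= [fz gKC] Kz.
have Cz : C z by exact: subset_closure.
have /gKC : (g @` (K `&` C)) (g z) by exists z.
by rewrite /O /= => /U1U /(_ (fC _ Cz)); rewrite opprB addrA subrK.
Qed.

Lemma compact_open_sub_near f g (W : set {compact-open, X -> Y}) :
  continuous f -> continuous g ->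
  nbhs ((f \- g) : {compact-open, X -> Y}) W ->
  exists P Q : set {compact-open, X -> Y},
    [/\ nbhs (f : {compact-open, X -> Y}) P,
        nbhs (g : {compact-open, X -> Y}) Q &
        forall f' g' : X -> Y, P f' -> Q g' -> W (f' \- g')].
Proof.
move=> cf cg.
pose nb (h : {compact-open, X -> Y}) := nbhs h.
pose F : set_system {compact-open, X -> Y} := [set W |
  exists P Q : set {compact-open, X -> Y},
    [/\ nb f P, nb g Q & forall f' g' : X -> Y, P f' -> Q g' -> W (f' \- g')]].
have FF : Filter F.
  split.
  - by exists setT, setT; split => //; exact: filterT.
  - move=> A B [P [Q [fP gQ PQ]]] [P' [Q' [fP' gQ' PQ']]].
    exists (P `&` P'), (Q `&` Q'); split; try exact: filterI.
    by move=> f' g' [? ?] [? ?]; split; [exact: PQ|exact: PQ'].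
  - move=> A B AB [P [Q [fP gQ PQ]]]; exists P, Q; split => // f' g' Pf' Qg'.
    exact/AB/PQ.
suff : {compact-open, F --> (f \- g)} by apply.
apply/compact_open_cvgP => K O cK oO KO.
have ch := continuous_subf cf cg.
have /nbhs0_sub[V [oV V0 VO]] := compact_open_tube ch cK oO KO.
have nV : nbhs 0 V by exact: open_nbhs_nbhs.
exists [set f' | forall x, K x -> V (f' x - f x)],
  [set g' | forall x, K x -> V (g' x - g x)]; split.
- exact: compact_open_near.
- exact: compact_open_near.
move=> f' g' ff' gg' _ [x Kx <-] /=.
have := VO _ _ (ff' x Kx) (gg' x Kx) x Kx.
by rewrite /= opprB addrA [f x - g x + _]addrC !subrKA.
Qed.
End compact_open_sub.

Section dual.
Context (R : realType) (G : topologicalZmodType).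

Definition characters : set {compact-open, G -> circle R} :=
  [set f | continuous (f : G -> circle R) /\
           {morph (f : G -> circle R) : x y / x + y}].

(* The Pontryagin dual, with the compact-open topology (the topology on the
   coercion of a set to a type is the one induced by the ambient space). *)
Definition pontryagin_dual : Type := characters.

HB.instance Definition _ := Topological.on pontryagin_dual.

Definition character_fun (f : pontryagin_dual) : G -> circle R := \val f.

Fact character_fun_inj : injective character_fun.
Proof. exact: val_inj. Qed.

Fact character_continuous (f : pontryagin_dual) : continuous (character_fun f).
Proof. by have [] := set_valP f. Qed.

Fact characterD (f : pontryagin_dual) : {morph character_fun f : x y / x + y}.
Proof. by have [] := set_valP f. Qed.

Fact dual_zero_subproof : characters (fun=> 0).
Proof. by split=> [x|x y]; [exact: cvg_cst|rewrite addr0]. Qed.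

Definition dual_zero : pontryagin_dual :=
  exist (fun f => f \in characters) _ (mem_set dual_zero_subproof).

Fact dual_opp_subproof (f : pontryagin_dual) :
  characters (fun x => - character_fun f x).
Proof.
split=> [x|x y]; last by rewrite characterD opprD.
by apply: (@continuous_comp _ _ _ (character_fun f) -%R);
  [exact: character_continuous|exact: opp_continuous].
Qed.

Definition dual_opp (f : pontryagin_dual) : pontryagin_dual :=
  exist (fun f => f \in characters) _ (mem_set (dual_opp_subproof f)).

Fact dual_add_subproof (f g : pontryagin_dual) :
  characters (fun x => character_fun f x + character_fun g x).
Proof.
split=> [|x y]; last by rewrite !characterD addrACA.
exact: (continuous_addf (@character_continuous f) (@character_continuous g)).
Qed.

Definition dual_add (f g : pontryagin_dual) : pontryagin_dual :=
  exist (fun f => f \in characters) _ (mem_set (dual_add_subproof f g)).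

Fact dual_addA : associative dual_add.
Proof. by move=> f g h; apply/character_fun_inj/funext => x; exact: addrA. Qed.
Fact dual_addC : commutative dual_add.
Proof. by move=> f g; apply/character_fun_inj/funext => x; exact: addrC. Qed.
Fact dual_add0 : left_id dual_zero dual_add.
Proof. by move=> f; apply/character_fun_inj/funext => x; exact: add0r. Qed.
Fact dual_addN : left_inverse dual_zero dual_opp dual_add.
Proof. by move=> f; apply/character_fun_inj/funext => x; exact: addNr. Qed.

HB.instance Definition _ :=
  GRing.isZmodule.Build pontryagin_dual dual_addA dual_addC dual_add0 dual_addN.

Fact dual_sub_continuous :
  continuous (fun p : pontryagin_dual * pontryagin_dual => p.1 - p.2).
Proof.
move=> [f g] W [_ [[B oB <-] Bfg BW]].
have nB : nbhs ((character_fun f \- character_fun g) : {compact-open, _ -> _}) B.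
  by apply: open_nbhs_nbhs.
have [P [Q [fP gQ PQ]]] := compact_open_sub_near
  (@character_continuous f) (@character_continuous g) nB.
have val_c := @initial_continuous pontryagin_dual _
  (\val : pontryagin_dual -> {compact-open, G -> circle R}).
exists (\val @^-1` P, \val @^-1` Q) => /=.
  by split; [exact: (val_c f _ fP)|exact: (val_c g _ gQ)].
move=> [f' g'] /= [Pf' Qg']; apply: BW; exact: PQ.
Qed.

HB.instance Definition _ :=
  PreTopologicalNmodule_isTopologicalZmodule.Build pontryagin_dual dual_sub_continuous.

End dual.

Section inverse_limit.
Context (A : nat -> groupType) (phi : forall i, {multiplicative A i.+1 -> A i}).

(* phi i is the map A_(i+1) -> A_i; the limit gets the topology induced by the
   product of the discrete topologies. *)
Definition inverse_limit :
    set (prod_topology (fun i => discrete_topology (A i))) :=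
  [set g | forall i, phi i (g i.+1) = g i].

Definition isomorphic_to_inverse_limit (H : topologicalZmodType) :=
  exists f : H -> inverse_limit, homeomorphism f /\
    forall (x y : H) (i : nat),
      \val (f (x + y)) i = (\val (f x) i * \val (f y) i)%g.

(* The injections code i identify the A_i with subsets of nat. As these subsets
   are uniformly decidable, a partial recursive function defined on the domain
   of an operation extends to a total recursive one. *)
Context (code : forall i, A i -> nat).

Definition uniformly_computable_groups :=
  [/\ forall i, injective (@code i),
      computable2 (fun i n => `[< range (@code i) n >] : nat),
      computable1 (fun i => @code i 1%g),
      exists2 inv, computable2 inv &
        forall i (x : A i), inv i (code x) = code (x^-1)%g
    & exists2 mul, computable3 mul &
        forall i (x y : A i), mul i (code x) (code y) = code (x * y)%g].

Definition uniformly_computable_maps :=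
  exists2 F, computable2 F &
    forall i (x : A i.+1), F i (code x) = code (phi i x).

Definition bonding_kernel (i : nat) : set (A i.+1) := [set x | phi i x = 1%g].
Arguments bonding_kernel : clear implicits.

Definition computable_kernels :=
  exists2 k, computable1 k &
    forall i, strong_index_set (k i) = @code i.+1 @` bonding_kernel i.

End inverse_limit.

Definition has_computable_tdlc_presentation (H : topologicalZmodType) :=
  exists (A : nat -> groupType) (phi : forall i, {multiplicative A i.+1 -> A i})
    (code : forall i, A i -> nat),
    [/\ forall i (y : A i), exists x, phi i x = y,
        isomorphic_to_inverse_limit phi H,
        uniformly_computable_groups code /\ uniformly_computable_maps phi code,
        forall i, finite_set (@bonding_kernel A phi i)
      & computable_kernels phi code].

(* Main.v *)
From HB Require Import structures.
Require Import Defs.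
From mathcomp Require Import all_boot all_order all_algebra.
From mathcomp Require Import all_classical all_reals all_analysis.
From mathcomp Require Import zify lra.
Set Implicit Arguments.
Unset Strict Implicit.
Unset Printing Implicit Defensive.
Import Order.TTheory GRing.Theory Num.Theory.
Import numFieldNormedType.Exports.
Local Open Scope classical_set_scope.

(* Idea. Let [H] be the limit of finite-kernel quotients H/K_i, presented computably.
   If the dual of [H] is totally disconnected, then H/K_0 is torsion: an element of
   infinite order gives a nonzero homomorphism H -> R, hence a path of characters.
   So [H] is the increasing union of compact open subgroups F_n, the preimages of
   finite subgroups of H/K_0, which can be found by search; the dual of [H] is the
   limit of the restrictions to the F_n.  A character of F_n factors through a finite
   group F_n/K_i and is a table of fractions, so these restrictions can be coded by
   numbers.  The kernel of restriction from F_(n+1) to F_n consists of characters of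
   the finite group F_(n+1)/K_0 and can be enumerated.

   Conversely, apply this to the dual of [G] and use Pontryagin duality.  Compact open
   subgroups V form a base in [G]. A character xi of the dual kills the characters
   trivial on some V + <c_1, ..., c_k>, so by induction on k it is evaluation at some
   x_V on the annihilator of V; by compactness the cosets x_V + V have a common point. *)

(** * Recursive functions *)

(** The class [recursive] consists of total functions, while the natural operations on codes are
    partial. Each search is therefore guarded by a decidable condition under which it succeeds, and
    returns 0 elsewhere. A character factors through every sufficiently deep level and so has many
    codes; the least one is taken, and equality of restrictions to F_n is decidable because both are
    finite tables. Divisibility of the circle makes every additive table on F_n the restriction of a
    character of [H]. The strong indices of the kernels let the layers be computed: from F_n/K_i
    they determine the finite preimage F_n/K_(i+1). The bound on the kernel of restriction comes
    from the inclusion of K_0 in F_n. The groups of a presentation form a dependent family. Working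
    with functions from [H] to codes removes this dependency, and transport along the isomorphism
    with the bidual becomes composition. *)

Lemma rec_ext n (f g : n.-tuple nat -> nat) :
  f =1 g -> recursive f -> recursive g.
Proof. by move=> /funext ->. Qed.

Definition rec_tuple m n (s : n.-tuple nat -> m.-tuple nat) :=
  forall i, recursive (fun t => tnth (s t) i).

Lemma rec_sub m n (f : m.-tuple nat -> nat) (s : n.-tuple nat -> m.-tuple nat) :
  recursive f -> rec_tuple s -> recursive (fun t => f (s t)).
Proof.
move=> rf rs; apply: rec_ext (recursive_comp rf rs) => t; congr f.
by apply: eq_from_tnth => i; rewrite tnth_mktuple.
Qed.

Lemma rec_tuple_id n : rec_tuple (fun t : n.-tuple nat => t).
Proof. by move=> i; apply: recursive_proj. Qed.

Lemma rec_tuple_behead m n (s : n.-tuple nat -> m.+1.-tuple nat) :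
  rec_tuple s -> rec_tuple (fun t => behead_tuple (s t)).
Proof.
move=> rs i; apply: rec_ext (rs (lift ord0 i)) => t.
by rewrite tnth_behead; congr tnth; apply: val_inj; rewrite /= inordK ?ltnS.
Qed.

Lemma rec_thead m n (s : n.-tuple nat -> m.+1.-tuple nat) :
  rec_tuple s -> recursive (fun t => thead (s t)).
Proof. by move=> rs; apply: rs. Qed.

Lemma rec_comp1 n (f : nat -> nat) (g : n.-tuple nat -> nat) :
  computable1 f -> recursive g -> recursive (fun t => f (g t)).
Proof.
move=> rf rg; apply: rec_ext (recursive_comp rf (g := fun=> g) _) => // t /=.
by rewrite enum_ordSl.
Qed.

Lemma rec_comp2 n (f : nat -> nat -> nat) (g h : n.-tuple nat -> nat) :
  computable2 f -> recursive g -> recursive h ->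
  recursive (fun t => f (g t) (h t)).
Proof.
move=> rf rg rh.
apply: rec_ext (recursive_comp rf (g := tnth [tuple g; h]) _) => [t /=|].
  by rewrite !enum_ordSl.
by case=> [[|[]]].
Qed.

Lemma rec_comp3 n (f : nat -> nat -> nat -> nat) (g h k : n.-tuple nat -> nat) :
  computable3 f -> recursive g -> recursive h -> recursive k ->
  recursive (fun t => f (g t) (h t) (k t)).
Proof.
move=> rf rg rh rk.
apply: rec_ext (recursive_comp rf (g := tnth [tuple g; h; k]) _) => [t /=|].
  by rewrite !enum_ordSl.
by case=> [[|[|[]]]].
Qed.

(** From here on arguments are read by iterating [behead_tuple] and then [thead], as with de Bruijn
    indices; this is the form that the automation below recognizes. *)
Lemma rec_computable1 (f : nat -> nat) :
  recursive (fun t : 1.-tuple nat => f (thead t)) -> computable1 f.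
Proof. by apply: rec_ext => -[[|a []]]. Qed.

Lemma rec_computable2 (f : nat -> nat -> nat) :
  recursive (fun t : 2.-tuple nat => f (thead t) (thead (behead_tuple t))) ->
  computable2 f.
Proof. by apply: rec_ext => -[[|a [|b []]]]. Qed.

Lemma rec_computable3 (f : nat -> nat -> nat -> nat) :
  recursive (fun t : 3.-tuple nat => f (thead t) (thead (behead_tuple t))
    (thead (behead_tuple (behead_tuple t)))) ->
  computable3 f.
Proof. by apply: rec_ext => -[[|a [|b [|c []]]]]. Qed.

(** Primitive recursion to depth [a t] with all of [t] kept as parameters: the recursor is applied
    to the tuple [a t :: t]. *)
Lemma rec_nat_rect n (f : n.-tuple nat -> nat)
    (g : nat -> nat -> n.-tuple nat -> nat) (a : n.-tuple nat -> nat) :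
  recursive f ->
  recursive (fun t : n.+2.-tuple nat =>
    g (thead t) (thead (behead_tuple t)) (behead_tuple (behead_tuple t))) ->
  recursive a ->
  recursive (fun t =>
    nat_rect (fun=> nat) (f t) (fun k r => g k r t) (a t)).
Proof.
move=> rf rg ra; have rp := recursive_primrec rf rg.
pose s (t : n.-tuple nat) := [tuple of a t :: t].
have rs : rec_tuple s.
  move=> i; case: (unliftP ord0 i) => [j|] ->.
    by apply: rec_ext (recursive_proj j) => t; rewrite tnthS.
  by apply: rec_ext ra => t; rewrite tnth0.
apply: rec_ext (rec_sub rp rs) => t /=; rewrite theadE.
have -> : [tuple of behead (s t)] = t by apply: val_inj.
by elim: (a t) => //= k ->; congr g; apply: val_inj.
Qed.

Lemma rec_const n c : recursive (fun _ : n.-tuple nat => c).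
Proof.
elim: c => [|c IH]; first exact: recursive_zero.
apply: rec_ext (recursive_comp recursive_succ (fun=> IH)) => t.
by rewrite /thead tnth_mktuple.
Qed.

Lemma rec_S n (f : n.-tuple nat -> nat) :
  recursive f -> recursive (fun t => (f t).+1).
Proof.
move=> rf; apply: rec_ext (recursive_comp recursive_succ (fun=> rf)) => t.
by rewrite /thead tnth_mktuple.
Qed.

Lemma rec_ex_minn n (P : nat -> n.-tuple nat -> bool)
    (exP : forall t, exists k, P k t) :
  recursive (fun t : n.+1.-tuple nat => P (thead t) (behead_tuple t) : nat) ->
  recursive (fun t => ex_minn (exP t)).
Proof.
move=> rP.
(* This recursion sends 0 to 1 and any successor to 0, so that the truth of [P] becomes a zero,
   which is what minimization looks for. *)
have rQ : recursive (fun t : n.+1.-tuple nat =>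
    nat_rect (fun=> nat) 1 (fun _ _ => 0)
      (P (thead t) (behead_tuple t) : nat)).
  apply: (rec_nat_rect (f := fun=> 1) (g := fun _ _ _ => 0)) => //;
  exact: rec_const.
have PE k t : (nat_rect (fun=> nat) 1 (fun _ _ => 0)
    (P (thead (cons_tuple k t)) (behead_tuple (cons_tuple k t)) : nat) == 0)
    = P k t.
  rewrite theadE; have -> : behead_tuple (cons_tuple k t) = t by exact: val_inj.
  by case: (P k t).
have regular t : exists k, nat_rect (fun=> nat) 1 (fun _ _ => 0)
    (P (thead (cons_tuple k t)) (behead_tuple (cons_tuple k t)) : nat) == 0.
  by have [k Pk] := exP t; exists k; rewrite PE.
apply: rec_ext (recursive_min regular rQ) => t.
case: ex_minnP => k; rewrite PE => Pk kmin.
case: ex_minnP => l Pl lmin; apply/eqP; rewrite eqn_leq lmin// kmin//.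
by rewrite PE.
Qed.

Ltac rec_var := first
  [ apply: rec_tuple_id | apply: rec_tuple_behead; rec_var ].

(* Recursiveness is proved by a search guided by the syntax of the body: closure lemmas are added to
   this base as hints keyed on the head symbol. *)
Create HintDb recursive.

Ltac rec := solve [typeclasses eauto with recursive].

#[local] Hint Extern 0 (recursive _) => assumption : recursive.
#[local] Hint Extern 1 (recursive (fun _ => ?c)) => apply: rec_const : recursive.
#[local] Hint Extern 1 (recursive (@thead _ _)) =>
  apply: (rec_thead (@rec_tuple_id _)) : recursive.
#[local] Hint Extern 1 (recursive (fun _ => thead _)) =>
  apply: rec_thead; rec_var : recursive.
#[local] Hint Extern 1 (recursive (fun _ => _.+1)) => apply: rec_S : recursive.
#[local] Hint Extern 5 (recursive _) => match goal with
  | H : recursive _ |- _ => apply: (rec_sub H); rec_var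
  | H : computable3 ?f |- recursive (fun t => ?f _ _ _) => apply: (rec_comp3 H)
  | H : computable2 ?f |- recursive (fun t => ?f _ _) => apply: (rec_comp2 H)
  | H : computable1 ?f |- recursive (fun t => ?f _) => apply: (rec_comp1 H)
  end : recursive.

Lemma rec_add n (f g : n.-tuple nat -> nat) : recursive f -> recursive g ->
  recursive (fun t => f t + g t).
Proof.
move=> rf rg; apply: (@rec_ext _ (fun t =>
  nat_rect (fun=> nat) (f t) (fun _ r => r.+1) (g t))) => [t|].
  by elim: (g t) => [|k /= ->]; rewrite ?addn0 ?addnS.
by apply: (rec_nat_rect (g := fun _ r _ => r.+1)); rec.
Qed.
#[local] Hint Extern 1 (recursive (fun _ => _ + _)) =>
  apply: rec_add : recursive.

Lemma rec_pred n (f : n.-tuple nat -> nat) : recursive f ->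
  recursive (fun t => (f t).-1).
Proof.
move=> rf; apply: (@rec_ext _ (fun t =>
  nat_rect (fun=> nat) 0 (fun k _ => k) (f t))) => [t|].
  by case: (f t).
by apply: (rec_nat_rect (f := fun=> 0) (g := fun k _ _ => k)); rec.
Qed.
#[local] Hint Extern 1 (recursive (fun _ => _.-1)) =>
  apply: rec_pred : recursive.
Lemma rec_sub_nat n (f g : n.-tuple nat -> nat) :
  recursive f -> recursive g -> recursive (fun t => f t - g t).
Proof.
move=> rf rg; apply: (@rec_ext _ (fun t =>
  nat_rect (fun=> nat) (f t) (fun _ r => r.-1) (g t))) => [t|].
  by elim: (g t) => [|k /= ->]; rewrite ?subn0 ?subnS.
by apply: (rec_nat_rect (g := fun _ r _ => r.-1)); rec.
Qed.
#[local] Hint Extern 1 (recursive (fun _ => _ - _)) =>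
  apply: rec_sub_nat : recursive.

Lemma rec_mul n (f g : n.-tuple nat -> nat) : recursive f -> recursive g ->
  recursive (fun t => f t * g t).
Proof.
move=> rf rg; apply: (@rec_ext _ (fun t =>
  nat_rect (fun=> nat) 0 (fun _ r => r + f t) (g t))) => [t|].
  by elim: (g t) => [|k /= ->]; rewrite ?muln0 ?mulnS// addnC.
by apply: (rec_nat_rect (f := fun=> 0) (g := fun _ r t => r + f t)); rec.
Qed.
#[local] Hint Extern 1 (recursive (fun _ => _ * _)) =>
  apply: rec_mul : recursive.
Lemma rec_exp n (f g : n.-tuple nat -> nat) : recursive f -> recursive g ->
  recursive (fun t => f t ^ g t).
Proof.
move=> rf rg; apply: (@rec_ext _ (fun t =>
  nat_rect (fun=> nat) 1 (fun _ r => r * f t) (g t))) => [t|].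
  by elim: (g t) => [|k /= ->]; rewrite ?expn0 ?expnSr.
by apply: (rec_nat_rect (f := fun=> 1) (g := fun _ r t => r * f t)); rec.
Qed.
#[local] Hint Extern 1 (recursive (fun _ => _ ^ _)) =>
  apply: rec_exp : recursive.

Lemma rec_fact n (f : n.-tuple nat -> nat) : recursive f ->
  recursive (fun t => (f t)`!).
Proof.
move=> rf; apply: (@rec_ext _ (fun t =>
  nat_rect (fun=> nat) 1 (fun k r => k.+1 * r) (f t))) => [t|].
  by elim: (f t) => [|k /= ->]; rewrite ?fact0 ?factS.
by apply: (rec_nat_rect (f := fun=> 1) (g := fun k r _ => k.+1 * r)); rec.
Qed.
#[local] Hint Extern 1 (recursive (fun _ => _`!)) =>
  apply: rec_fact : recursive.

Lemma rec_leq n (f g : n.-tuple nat -> nat) : recursive f -> recursive g ->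
  recursive (fun t => (f t <= g t : nat)).
Proof.
move=> rf rg; apply: (@rec_ext _ (fun t => 1 - (f t - g t))); last by rec.
by move=> t; rewrite -subn_eq0; case: (f t - g t) => //= k; rewrite subSS.
Qed.
#[local] Hint Extern 1 (recursive (fun _ => nat_of_bool (_ <= _))) =>
  apply: rec_leq : recursive.

Lemma rec_andb n (P Q : n.-tuple nat -> bool) : recursive P -> recursive Q ->
  recursive (fun t => P t && Q t : nat).
Proof.
move=> rP rQ; apply: (@rec_ext _ (fun t => P t * Q t)); last by rec.
by move=> t; rewrite mulnb.
Qed.
#[local] Hint Extern 1 (recursive (fun _ => nat_of_bool (_ && _))) =>
  apply: rec_andb : recursive.

Lemma rec_negb n (P : n.-tuple nat -> bool) : recursive P ->
  recursive (fun t => ~~ P t : nat).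
Proof.
move=> rP; apply: (@rec_ext _ (fun t => 1 - P t)); last by rec.
by move=> t; case: (P t).
Qed.
#[local] Hint Extern 1 (recursive (fun _ => nat_of_bool (~~ _))) =>
  apply: rec_negb : recursive.
Lemma rec_orb n (P Q : n.-tuple nat -> bool) : recursive P -> recursive Q ->
  recursive (fun t => P t || Q t : nat).
Proof.
move=> rP rQ; apply: (@rec_ext _ (fun t => ~~ (~~ P t && ~~ Q t))); last by rec.
by move=> t; rewrite negb_and !negbK.
Qed.
#[local] Hint Extern 1 (recursive (fun _ => nat_of_bool (_ || _))) =>
  apply: rec_orb : recursive.

Lemma rec_implb n (P Q : n.-tuple nat -> bool) : recursive P -> recursive Q ->
  recursive (fun t => P t ==> Q t : nat).
Proof.
move=> rP rQ; apply: (@rec_ext _ (fun t => ~~ (P t && ~~ Q t))); last by rec.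
by move=> t; rewrite implybE negb_and negbK.
Qed.
#[local] Hint Extern 1 (recursive (fun _ => nat_of_bool (_ ==> _))) =>
  apply: rec_implb : recursive.

Lemma rec_eqn n (f g : n.-tuple nat -> nat) : recursive f -> recursive g ->
  recursive (fun t => f t == g t : nat).
Proof.
move=> rf rg; apply: (@rec_ext _ (fun t => (f t <= g t) && (g t <= f t))).
  by move=> t; rewrite eqn_leq.
by rec.
Qed.
#[local] Hint Extern 1 (recursive (fun _ => nat_of_bool (_ == _))) =>
  apply: rec_eqn : recursive.

Definition bounded_all (b : nat) (P : pred nat) := all P (iota 0 b).

Lemma bounded_allP b (P : pred nat) : reflect (forall x, x < b ->
  P x) (bounded_all b P).
Proof.
by apply: (iffP allP) => Pb x; have := Pb x; rewrite mem_iota.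
Qed.

Definition bounded_ex (b : nat) (P : pred nat) := ~~ bounded_all b (predC P).

Lemma bounded_exP b (P : pred nat) : reflect (exists2 x, x < b & P x) (bounded_ex b P).
Proof.
rewrite /bounded_ex /bounded_all -has_predC; apply: (iffP hasP) => -[x].
  by rewrite mem_iota /= negbK => ? ?; exists x.
by move=> ? ?; exists x; rewrite ?mem_iota //= negbK.
Qed.

Lemma rec_bounded_all n (P : nat -> n.-tuple nat -> bool) (b : n.-tuple nat -> nat) :
  recursive b ->
  recursive (fun t : n.+1.-tuple nat => P (thead t) (behead_tuple t) : nat) ->
  recursive (fun t => bounded_all (b t) (fun x => P x t) : nat).
Proof.
move=> rb rP; apply: (@rec_ext _ (fun t => nat_rect (fun=> nat) 1
  (fun k r => r * P k t) (b t))) => [t|].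
  rewrite /bounded_all; elim: (b t) => // k IH.
  have -> : iota 0 k.+1 = iota 0 k ++ [:: k] by rewrite -[k.+1]addn1 iotaD.
  by rewrite all_cat /= IH mulnb andbT.
apply: (rec_nat_rect (f := fun=> 1) (g := fun k r t => r * P k t)) => //; first by rec.
apply: rec_mul; first by rec.
(* This substitution drops the second entry, the accumulated product, which [P] does not see. *)
have rs : rec_tuple (fun t : n.+2.-tuple nat =>
    [tuple of thead t :: behead_tuple (behead_tuple t)]).
  move=> i; case: (unliftP ord0 i) => [j|] ->.
    under eq_fun do rewrite tnthS.
    by apply: rec_tuple_behead; rec_var.
  by under eq_fun do rewrite tnth0; rec.
apply: rec_ext (rec_sub rP rs) => t; rewrite theadE.
by congr (nat_of_bool (P _ _)); apply: val_inj.
Qed.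
#[local] Hint Extern 1 (recursive (fun _ => nat_of_bool (bounded_all _ _))) =>
  apply: rec_bounded_all : recursive.

Lemma rec_bounded_ex n (P : nat -> n.-tuple nat -> bool) (b : n.-tuple nat -> nat) :
  recursive b ->
  recursive (fun t : n.+1.-tuple nat => P (thead t) (behead_tuple t) : nat) ->
  recursive (fun t => bounded_ex (b t) (fun x => P x t) : nat).
Proof.
move=> rb rP; apply: rec_negb; apply: (rec_bounded_all (P := fun x t => ~~ P x t)) =>
  //.
exact: rec_negb.
Qed.
#[local] Hint Extern 1 (recursive (fun _ => nat_of_bool (bounded_ex _ _))) =>
  apply: rec_bounded_ex : recursive.

(** The quotient is the least [k] with [f t < k.+1 * g t]. The disjunct [g t == 0] keeps the search
    total and makes it return 0, in agreement with [divn0]. *)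
Lemma rec_divn n (f g : n.-tuple nat -> nat) : recursive f -> recursive g ->
  recursive (fun t => f t %/ g t).
Proof.
move=> rf rg.
have exP t : exists k, (g t == 0) || (f t < k.+1 * g t).
  have [->|g0] := posnP (g t); first by exists 0.
  by exists (f t %/ g t); rewrite ltn_ceil ?orbT.
have := @rec_ex_minn n (fun k t => (g t == 0) || (f t < k.+1 * g t)) exP _.
move=> H; apply: rec_ext (H _); last by rec.
move=> t; case: ex_minnP => k; have [g0|g0] := posnP (g t).
  by move=> _ /(_ 0 isT); rewrite g0 divn0; case: k.
move=> fk kmin; apply/eqP; rewrite eqn_leq kmin ?ltn_ceil//=.
by rewrite -ltnS ltn_divLR.
Qed.
#[local] Hint Extern 1 (recursive (fun _ => _ %/ _)) =>
  apply: rec_divn : recursive.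

Lemma rec_modn n (f g : n.-tuple nat -> nat) : recursive f -> recursive g ->
  recursive (fun t => f t %% g t).
Proof.
move=> rf rg; apply: (@rec_ext _ (fun t => f t - f t %/ g t * g t)).
  by move=> t; rewrite {1}(divn_eq (f t) (g t)) addKn.
by apply: rec_sub_nat => //; apply: rec_mul => //; apply: rec_divn.
Qed.
#[local] Hint Extern 1 (recursive (fun _ => _ %% _)) =>
  apply: rec_modn : recursive.

Lemma rec_odd n (f : n.-tuple nat -> nat) : recursive f ->
  recursive (fun t => odd (f t) : nat).
Proof.
move=> rf; apply: (@rec_ext _ (fun t => f t %% 2)).
  by move=> t; rewrite modn2.
by apply: rec_modn => //; rec.
Qed.
#[local] Hint Extern 1 (recursive (fun _ => nat_of_bool (odd _))) =>
  apply: rec_odd : recursive.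

(* The guard [g] makes regular a search that succeeds only on meaningful arguments. *)
Definition search (g : bool) (P : pred nat) : nat :=
  match pselect (exists k, g ==> P k) with
  | left exP => ex_minn exP
  | right _ => 0
  end.

Lemma searchP (g : bool) (P : pred nat) : (g -> exists k, P k) -> g ->
  P (search g P) /\ forall k, P k -> search g P <= k.
Proof.
move=> exP gT; rewrite /search; case: pselect => [exgP|[]]; last first.
  by have [k Pk] := exP gT; exists k; rewrite gT.
case: ex_minnP => k; rewrite gT /= => Pk kmin; split=> // l Pl.
Qed.

Lemma rec_search n (g : n.-tuple nat -> bool) (P : nat -> n.-tuple nat -> bool) :
  (forall t, g t -> exists k, P k t) ->
  recursive g ->
  recursive (fun t : n.+1.-tuple nat => P (thead t) (behead_tuple t) : nat) ->
  recursive (fun t => search (g t) (fun k => P k t)).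
Proof.
move=> exP rg rP.
have exgP t : exists k, g t ==> P k t.
  by case: (boolP (g t)) => [/exP[k Pk]|_]; [exists k|exists 0].
have := @rec_ex_minn n (fun k t => g t ==> P k t) exgP.
move=> H; apply: rec_ext (H _); last by rec.
move=> t; rewrite /search; case: pselect => [e|[]]; last exact: exgP.
case: ex_minnP => k Pk kmin; case: ex_minnP => l Pl lmin.
by apply/eqP; rewrite eqn_leq kmin ?lmin.
Qed.

Local Open Scope ring_scope.

(** * Divisible groups are injective *)

Definition subgroup (M : zmodType) (V : set M) :=
  V 0 /\ forall x y, V x -> V y -> V (x - y).

Section subgroup.
Context (M : zmodType) (V : set M) (sV : subgroup V).

Lemma subgroup0 : V 0. Proof. by case: sV. Qed.

Lemma subgroupB x y : V x -> V y -> V (x - y). Proof. by apply: sV.2. Qed.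

Lemma subgroupN x : V x -> V (- x).
Proof. by move=> Vx; rewrite -sub0r; apply: subgroupB => //; exact: subgroup0. Qed.

Lemma subgroupD x y : V x -> V y -> V (x + y).
Proof. by move=> Vx Vy; rewrite -[y]opprK; apply: subgroupB => //;
  exact: subgroupN. Qed.

Lemma subgroupMn x n : V x -> V (x *+ n).
Proof.
by move=> Vx; elim: n => [|n IH]; [exact: subgroup0|rewrite mulrS; exact: subgroupD].
Qed.

Lemma subgroupMz x k : V x -> V (x *~ k).
Proof.
by move=> Vx; case: k => n; [exact: subgroupMn|apply/subgroupN/subgroupMn].
Qed.

End subgroup.

Section additive_functions.
Context (M D : zmodType) (g : M -> D) (gD : {morph g : x y / x + y}).

Lemma addf0 : g 0 = 0.
Proof. by apply: (addrI (g 0)); rewrite -gD !addr0. Qed.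

Lemma addfN x : g (- x) = - g x.
Proof. by apply: (addrI (g x)); rewrite -gD !subrr addf0. Qed.

Lemma addfB x y : g (x - y) = g x - g y.
Proof. by rewrite gD addfN. Qed.

Lemma addfMn x n : g (x *+ n) = g x *+ n.
Proof. by elim: n => [|n IH]; rewrite ?mulr0n ?addf0// !mulrS gD IH. Qed.

Lemma addfMz x k : g (x *~ k) = g x *~ k.
Proof. by case: k => n; rewrite ?NegzE -?pmulrn ?nmulrn ?addfN addfMn. Qed.

End additive_functions.

Lemma pair_mulrz (M D : zmodType) (x : M) (y : D) k :
  (x, y) *~ k = (x *~ k, y *~ k).
Proof.
by rewrite [LHS]surjective_pairing (addfMz (g := fst))// (addfMz (g := snd)).
Qed.

Section divisible_extension.
Context (M D : zmodType).
Hypothesis divisible : forall (d : D) n, (0 < n)%N -> exists e, e *+ n = d.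

(** The graph of a homomorphism from a subgroup of [M] to [D]: additivity is the subgroup condition,
    and single-valuedness reduces to the fibre over 0. *)
Definition partial_morphism (X : set (M * D)) :=
  subgroup X /\ forall d, X (0, d) -> d = 0.

(** If some positive multiple of [x] is in the domain, let [x *+ m] be the least one and choose [e]
    with [e *+ m] equal to its value, by divisibility. Otherwise the domain contains no nonzero
    multiple of [x] and [e = 0] will do. *)
Lemma partial_morphism_step (X : set (M * D)) (x : M) :
  partial_morphism X -> exists e, exists2 Y, partial_morphism Y &
  X `<=` Y /\ Y (x, e).
Proof.
move=> [sX X0].
have [e xe] : exists e : D, forall k b, X (x *~ k, b) -> b = e *~ k.
  have [exm|nom] := pselect (exists m, (0 < m)%N && `[< exists d, X (x *+ m, d) >]).
    case: (ex_minnP exm) => m /andP[m0 /asboolP[d Xd]] mmin.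
    have [e ed] := divisible d m0; exists e => k b Xb.
    pose q := (k %/ m)%Z; have kE : k = q * m + (k %% m)%Z := divz_eq k m.
    have := subgroupB sX Xb (subgroupMz sX q Xd).
    have -> : (x *~ k, b) - (x *+ m, d) *~ q = (x *~ (k %% m)%Z, b - e *~ (m%:Z * q)).
      have -> : (x *+ m, d) *~ q = (x *~ (m%:Z * q), e *~ (m%:Z * q)).
        by rewrite pair_mulrz !mulrzA -!pmulrn ed.
      congr (_, _); rewrite /= -mulrzBr; congr (_ *~ _).
      by rewrite {1}kE mulrC addrAC subrr add0r.
    have m0z : (0 : int) < m by rewrite ltz_nat.
    have := modz_ge0 k (lt0r_neq0 m0z); have := ltz_pmod k m0z.
    case: (modz k m) kE => // r kE rm _ Xr.
    have r0 : r = 0%N.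
      apply/eqP; apply: contraTT m0 => r0; suff : (m <= r)%N by lia.
      by apply: mmin; rewrite lt0n r0; apply/asboolP; eexists; exact: Xr.
    move: Xr; rewrite r0 mulr0z => /X0 /eqP; rewrite subr_eq0 => /eqP ->.
    by rewrite [in RHS]kE r0 addr0 mulrC.
  exists 0 => k b Xb; rewrite mul0rz.
  have [k0|k0] := eqVneq k 0; first by apply: X0; move: Xb; rewrite k0 mulr0z.
  exfalso; apply: nom; exists `|k|%N; rewrite absz_gt0 k0 /=; apply/asboolP.
  have [kE|kE] : k = `|k|%N \/ k = - `|k|%N%:Z by lia.
    by exists b; rewrite pmulrn -kE.
  exists (- b); have := subgroupN sX Xb; congr X; congr (_, _) => /=.
  by rewrite pmulrn -mulrNz; congr (_ *~ _); lia.
exists e, [set p | exists k y c, [/\ X (y, c), p.1 = y + x *~ k & p.2 = c + e *~ k]].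
  split; first split.
  - by exists 0, 0, 0; split; rewrite ?mulr0z ?addr0//; exact: (subgroup0 sX).
  - move=> a b [k [y [c [Xyc a1 a2]]]] [k' [y' [c' [Xyc' b1 b2]]]].
    exists (k - k'), (y - y'), (c - c'); split; first exact: (subgroupB sX Xyc Xyc').
      by rewrite /= a1 b1 mulrzBr opprD addrACA.
    by rewrite /= a2 b2 mulrzBr opprD addrACA.
  - move=> d [k [y [c [Xyc /= yk ->]]]].
    have /xe <- : X (x *~ k, - c); last by rewrite subrr.
    have := subgroupN sX Xyc; congr X; congr (_, _); apply/eqP.
    by rewrite eq_sym -addr_eq0 addrC -yk.
split=> [[y c] Xyc|]; first by exists 0, y, c; rewrite !mulr0z !addr0.
by exists 1, 0, 0; split; rewrite ?add0r//; exact: (subgroup0 sX).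
Qed.

Lemma partial_morphism_extend (X : set (M * D)) : partial_morphism X ->
  exists2 g : M -> D, {morph g : x y / x + y} & forall x d, X (x, d) -> g x = d.
Proof.
move=> pX; have [F Ftot Fchain|A [pA Amax]] :=
  @Zorn_bigcup _ (fun A => partial_morphism (A `|` X)).
  split; first split.
  - by right; apply: (subgroup0 pX.1).
  - move=> a b [[A FA Aa]|Xa] [[B FB Bb]|Xb].
    + have [AB|BA] := Fchain _ _ FA FB.
        by have [] := subgroupB (Ftot _ FB).1 (or_introl (AB _ Aa)) (or_introl Bb);
          [left; exists B|right].
      by have [] := subgroupB (Ftot _ FA).1 (or_introl Aa) (or_introl (BA _ Bb));
        [left; exists A|right].
    + by have [] := subgroupB (Ftot _ FA).1 (or_introl Aa) (or_intror Xb);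
        [left; exists A|right].
    + by have [] := subgroupB (Ftot _ FB).1 (or_intror Xa) (or_introl Bb);
        [left; exists B|right].
    + by right; exact: (subgroupB pX.1).
  - move=> d [[A FA Ad]|Xd]; last exact: pX.2.
    by apply: (Ftot _ FA).2; left.
have dom x : exists d, (A `|` X) (x, d).
  have [e [Y pY [AXY Yxe]]] := partial_morphism_step x pA.
  have [YA|YA] := pselect (Y `<=` A); first by exists e; left; exact: YA.
  exfalso; apply: (Amax Y); first by split => // a Aa; apply: AXY; left.
  rewrite (_ : Y `|` X = Y)//; apply/setUidPl => a Xa; apply: AXY; right => //.
have fn x d d' : (A `|` X) (x, d) -> (A `|` X) (x, d') -> d = d'.
  move=> Ad Ad'; apply/eqP; rewrite -subr_eq0; apply/eqP; apply: pA.2.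
  by have := subgroupB pA.1 Ad Ad'; congr (_ (_, _)); exact: subrr.
pose g x := projT1 (cid (dom x)).
have gP x : (A `|` X) (x, g x) by exact: projT2 (cid (dom x)).
exists g => [x y|x d Xxd]; last by apply: (fn _ _ _ (gP x)); right.
by apply: (fn _ _ _ (gP _)); exact: (subgroupD pA.1 (gP x) (gP y)).
Qed.

(** The hypothesis on [r] says that the two prescriptions agree on the multiples of [x] lying in
    [V], hence define a homomorphism on [V + Z x]. The lemma is used both for the reals and for the
    circle. *)
Lemma extend_by_zero (V : set M) (x : M) (r : D) : subgroup V ->
  (forall k, V (x *~ k) -> r *~ k = 0) ->
  exists2 g : M -> D, {morph g : x y / x + y} & (forall v, V v -> g v = 0) /\ g x = r.
Proof.
move=> sV Vr.
have [|g gD gE] := @partial_morphism_extend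
  [set p | exists v k, [/\ V v, p.1 = v + x *~ k & p.2 = r *~ k]].
  split; first split.
  - by exists 0, 0; rewrite !mulr0z addr0; split => //; exact: subgroup0.
  - move=> a b [v [k [Vv a1 a2]]] [w [l [Vw b1 b2]]]; exists (v - w), (k - l).
    by rewrite /= a1 a2 b1 b2 !mulrzBr opprD addrACA; split => //; exact: subgroupB.
  - move=> d /= [v [k [Vv /esym/eqP]]]; rewrite addrC addr_eq0 => /eqP vk ->.
    by apply: Vr; rewrite vk; exact: subgroupN.
exists g => //; split=> [v Vv|].
  by apply: gE; exists v, 0; rewrite !mulr0z addr0.
by apply: gE; exists 0, 1; rewrite add0r; split => //; exact: subgroup0.
Qed.

End divisible_extension.

(** * The circle *)

Section circle_facts.
Context (R : realType).
Local Notation pi := (@circle_pi R).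

Lemma circle_pi0 : pi 0 = 0.
Proof. by rewrite -[X in pi X](subrr 0) Defs.piB subrr. Qed.

Lemma circle_piD : {morph pi : x y / x + y}.
Proof.
move=> x y; rewrite -{1}[y]opprK -[- y]sub0r Defs.piB Defs.piB circle_pi0 sub0r opprK.
by [].
Qed.

Lemma circle_pi_eq0 x : pi x = 0 <-> x \is a Num.int.
Proof. by rewrite -circle_pi0 Defs.piE subr0. Qed.

Definition frac (m N : nat) : circle R := pi (m%:R / N%:R).

Lemma frac_eq m m' N : (0 < N)%N -> frac m N = frac m' N <-> m = m' %[mod N].
Proof.
move=> N0; have N0R : N%:R != 0 :> R by rewrite pnatr_eq0 -lt0n.
rewrite /frac Defs.piE -mulrBl; split.
  rewrite inE => /intrP[k /(canRL (mulfVK N0R))/eqP].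
  rewrite subr_eq !pmulrn -intrM -intrD eqr_int => /eqP mm'.
  suff: (m %% N)%Z = (m' %% N)%Z by rewrite !modz_nat => -[].
  by rewrite mm' modzMDl.
move=> mm'; rewrite (divn_eq m N) (divn_eq m' N) mm' !natrD !natrM.
rewrite opprD addrACA subrr addr0 -mulrBl mulfK// inE.
by rewrite rpredB// natr_int.
Qed.

Lemma fracD m m' N : frac (m + m') N = frac m N + frac m' N.
Proof. by rewrite /frac natrD mulrDl circle_piD. Qed.

Lemma fracM m N k : (0 < k)%N -> frac (m * k) (N * k) = frac m N.
Proof.
move=> k0; rewrite /frac !natrM -mulf_div divff ?mulr1//.
by rewrite pnatr_eq0 -lt0n.
Qed.

Lemma frac0 N : frac 0 N = 0.
Proof. by rewrite /frac mul0r circle_pi0. Qed.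

Lemma frac_natmul m N k : frac m N *+ k = frac (m * k) N.
Proof.
elim: k => [|k IH]; first by rewrite muln0 frac0.
by rewrite mulrS IH -fracD mulnS.
Qed.

Lemma frac_modn m N : (0 < N)%N -> frac (m %% N) N = frac m N.
Proof. by move=> N0; apply/frac_eq => //; rewrite modn_mod. Qed.

Lemma fracNN N : (0 < N)%N -> frac N N = 0.
Proof. by move=> N0; rewrite -(frac0 N); apply/frac_eq => //; rewrite modnn mod0n. Qed.

Lemma circle_torsion (c : circle R) n : (0 < n)%N -> c *+ n = 0 ->
  exists2 k, (k < n)%N & c = frac k n.
Proof.
move=> n0; have [x <-] := Defs.pi_surj c; rewrite -(addfMn circle_piD).
have n0R : n%:R != 0 :> R by rewrite pnatr_eq0 -lt0n.
move=> /circle_pi_eq0; rewrite -mulr_natr => /intrP[k /(canRL (mulfK n0R)) ->].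
have n0z : n%:Z != 0 by rewrite eqz_nat -lt0n.
have := modz_ge0 k n0z; have := ltz_pmod k (d := n%:Z).
rewrite ltz_nat => /(_ n0); have := divz_eq k n.
case: (modz k n) => // r kE rn _; exists r => //.
apply/Defs.piE; rewrite kE intrD intrM -mulrBl addrK -!pmulrn mulfK//.
by rewrite inE intr_int.
Qed.

Lemma circle_divisible (c : circle R) n : (0 < n)%N -> exists e, e *+ n = c.
Proof.
move=> n0; have [x <-] := Defs.pi_surj c; exists (pi (x / n%:R)).
by rewrite -(addfMn circle_piD) -[X in pi X]mulr_natr divfK// pnatr_eq0 -lt0n.
Qed.

Lemma real_divisible (x : R) n : (0 < n)%N -> exists e, e *+ n = x.
Proof.
by move=> n0; exists (x / n%:R); rewrite -[LHS]mulr_natr divfK// pnatr_eq0 -lt0n.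
Qed.

Definition small_arc : set (circle R) := pi @` [set x | `|x| < 4^-1].

Lemma small_arc_open : open small_arc.
Proof.
apply: open_pi; rewrite (_ : [set x | _] = ball (0 : R) 4^-1); first exact: ball_open.
by apply/seteqP; split=> x /=; rewrite -ball_normE /= sub0r normrN.
Qed.

Lemma small_arc0 : small_arc 0.
Proof. by exists 0; rewrite ?circle_pi0//= normr0 invr_gt0. Qed.

(* If [0 < `|x| < 1/4], the first multiple of [`|x|] reaching [1/4] is below [1/2]. *)
Lemma no_small_subgroups (c : circle R) : (forall n, small_arc (c *+ n)) -> c = 0.
Proof.
move=> small; have [x /= x4 xc] := small 1%N; rewrite mulr1n in xc.
have [->//|x0] := eqVneq c 0; have nx0 : 0 < `|x|.
  by rewrite normr_gt0; apply: contra_neq x0 => x0; rewrite -xc x0 circle_pi0.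
have exn : exists n, 4^-1 <= `|x| *+ n.
  exists (Num.bound (4^-1 / `|x|)); rewrite -[leRHS]mulr_natr mulrC -ler_pdivrMr//.
  by apply/ltW/archi_boundP; rewrite divr_ge0// invr_ge0.
case: (ex_minnP exn) => -[|n] xn nmin; first by move: xn;
  rewrite mulr0n leNgt invr_gt0 ltr0n.
have {}nmin : `|x| *+ n < 4^-1.
  by rewrite ltNge; apply/negP => /nmin; rewrite ltnn.
have [y /= y4 /esym] := small n.+1; rewrite -xc -(addfMn circle_piD) => /Defs.piE.
rewrite inE => /intrP[k xyk].
(* Here [k] is [x *+ n.+1 - y], where [x *+ n.+1] has absolute value in [1/4, 1/2) and [y] has
   absolute value below 1/4. Hence [0 < |k| < 1], impossible for an integer. *)
have : `|x *+ n.+1| - `|y| <= `|k%:~R : R| by rewrite -xyk lerB_dist.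
have : `|k%:~R : R| <= `|x *+ n.+1| + `|y| by rewrite -xyk ler_normB.
rewrite normrMn -intr_norm; move: xn; rewrite (mulrS `|x|) => xn h1 h2.
clear c small xc x0 xyk.
have k0 : `|k| < 1 by rewrite -(ltr_int R) mulr1z; lra.
have k1 : 0 < `|k| by rewrite -(ltr_int R) mulr0z; lra.
by lia.
Qed.

Lemma circle_pi_surj_itv (c : circle R) : exists2 x, 0 <= x < 1 & pi x = c.
Proof.
have [x <-] := Defs.pi_surj c; exists (x - (Num.floor x)%:~R).
  by rewrite subr_ge0 floor_le_tmp ltrBlDr addrC -[1]/(1%:~R) -intrD floorD1_gt.
by apply/Defs.piE; rewrite addrAC subrr add0r inE rpredN intr_int.
Qed.

Lemma compact_circle : compact [set: circle R].
Proof.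
have -> : [set: circle R] = pi @` `[0, 1]%classic.
  apply/seteqP; split=> // c _; have [x /andP[x0 x1] <-] := circle_pi_surj_itv c.
  by exists x; rewrite //= in_itv /= x0 ltW.
apply: continuous_compact; last exact: segment_compact.
by apply: continuous_subspaceT => x; exact: circle_pi_continuous.
Qed.

Lemma circle_closed0 : closed [set (0 : circle R)].
Proof.
rewrite -[X in closed X]setCK; apply: open_closedC.
have -> : ~` [set (0 : circle R)] = pi @` `]0, 1[%classic.
  apply/seteqP; split=> [c|_ [x + <-]] /=.
    have [x /andP[x0 x1] <-] := circle_pi_surj_itv c => xn0; exists x => //.
    rewrite /= in_itv /= x1 andbT lt_neqAle x0 andbT.
    by apply/eqP => x0'; apply: xn0; rewrite -x0' circle_pi0.
  move=> /andP[x0 x1] /circle_pi_eq0 /intrP[k xk].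
  have k0 : 0 < k by rewrite -(ltr_int R) -xk.
  have k1 : k < 1 by rewrite -(ltr_int R) -xk.
  by lia.
by apply: open_pi; exact: interval_open.
Qed.

End circle_facts.

(** * Characters *)

Section topological_groups.
Context (G : topologicalZmodType).
Implicit Types (V : set G).

Lemma nbhs_translate V x : nbhs 0 V <-> nbhs x [set y | V (y - x)].
Proof.
split; first by move=> nV; exact: (@nbhs_subl G x V nV).
move=> nV; have c : {for (0 : G), continuous (fun z : G => z + x)}.
  apply: (@continuous_comp _ _ _ (fun v : G => (v, x)) (fun p : G * G => p.1 + p.2)).
    by apply: cvg_pair => /=; [exact: cvg_id|exact: cvg_cst].
  exact: add_continuous.
have := c [set y | V (y - x)]; rewrite add0r => /(_ nV) nV'.
have {}nV' : nbhs (0 : G) [set y | V (y + x - x)] by exact: nV'.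
by apply: filterS nV' => y /=; rewrite addrK.
Qed.

Lemma closed_subgroup V : subgroup V -> nbhs 0 V -> closed V.
Proof.
move=> sV nV; rewrite -[V]setCK; apply: open_closedC; rewrite openE => x nVx.
move/(nbhs_translate V x): nV; apply: filterS => y /= Vyx Vy; apply: nVx.
by rewrite -(subKr y x); exact: subgroupB.
Qed.

Lemma nbhs_shift V x : nbhs x V <-> nbhs 0 [set y | V (y + x)].
Proof.
rewrite (nbhs_translate _ x); rewrite (_ : [set y | _] = V)//.
by apply/funext => y /=; rewrite subrK.
Qed.

End topological_groups.

Lemma morph_continuous (G H : topologicalZmodType) (f : G -> H) :
  {morph f : x y / x + y} ->
  (forall U, nbhs 0 U -> nbhs 0 (f @^-1` U)) -> continuous f.
Proof.
move=> fD f0 x U /nbhs_shift /f0 /(nbhs_translate _ x); apply: filterS => y /=.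
by rewrite (addfB fD) subrK.
Qed.

Lemma morph_continuous_ker (G H : topologicalZmodType) (f : G -> H) (V : set G) :
  {morph f : x y / x + y} -> nbhs 0 V -> (forall x, V x -> f x = 0) ->
  continuous f.
Proof.
move=> fD nV fV; apply: morph_continuous => // U /nbhs_singleton U0.
by apply: filterS nV => x /fV /= ->.
Qed.

Section characters.
Context (R : realType) (G : topologicalZmodType).
Local Notation dual := (pontryagin_dual R G).
Implicit Types (V : set G) (X Y : dual).

Lemma character_exists (g : G -> circle R) :
  continuous g -> {morph g : x y / x + y} -> exists X, character_fun X = g.
Proof.
move=> cg gD; have gc : characters (g : {compact-open, G -> circle R}) by [].
by exists (exist (fun f => f \in @characters R G) _ (mem_set gc)).
Qed.

Lemma characterDE X Y x : character_fun (X + Y) x = character_fun X x + character_fun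
  Y x.
Proof. by []. Qed.

Lemma character0E x : character_fun (0 : dual) x = 0.
Proof. by []. Qed.

Lemma eval_morph x : {morph (fun X => character_fun X x) : X Y / X + Y}.
Proof. by []. Qed.

Definition annihilator V : set dual :=
  [set X | forall x, V x -> character_fun X x = 0].

Lemma annihilator_subgroup V : subgroup (annihilator V).
Proof.
split=> [x _|X Y X0 Y0 x Vx]; first exact: character0E.
by rewrite (addfB (eval_morph x)) X0// Y0// subrr.
Qed.

Lemma cvg_dual (T : Type) (F : set_system T) (f : T -> dual) X : Filter F ->
  (forall K O, compact K -> open O -> character_fun X @` K `<=` O ->
    \forall t \near F, character_fun (f t) @` K `<=` O) ->
  f @ F --> X.
Proof.
move=> FF fX N [_ [[B oB <-] BX BN]].
have : {compact-open, (fun t => character_fun (f t)) @ F --> character_fun X}.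
  by apply/compact_open_cvgP => K O; exact: fX.
move=> /(_ B) /=; have nB : nbhs (character_fun X : {compact-open, G -> circle R}) B.
  exact: open_nbhs_nbhs.
move=> /(_ nB) fB.
apply: (@filterS _ F FF (fun t => B (character_fun (f t))) _ _ fB) => t Bt.
exact: BN.
Qed.

(** On [K], a character killing [K] agrees with the zero character, so the filter generated by these
    annihilators converges to 0. Conversely [annihilator_nbhs] shows that they are neighbourhoods
    when the compact set is a subgroup. *)
Lemma nbhs_dual (N : set dual) : nbhs 0 N ->
  exists2 K : set G, compact K & annihilator K `<=` N.
Proof.
pose F := filter_from (@compact G) annihilator.
have FF : Filter F.
  apply: filter_from_filter; first by exists set0; exact: compact0.
  move=> K L cK cL; exists (K `|` L); first exact: compactU.
  by move=> X XKL; split=> x ?; apply: XKL; [left|right].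
have : (fun X => X) @ F --> (0 : dual).
  apply: cvg_dual => K O cK oO KO; exists K => // X XK _ [x Kx <-].
  by rewrite XK//; apply: KO; exists x.
by move=> + /= => /(_ N) /= /[apply] -[K cK KN]; exists K.
Qed.

Lemma nbhs_dual_compact (K : set G) (U : set (circle R)) :
  compact K -> nbhs 0 U -> nbhs (0 : dual) [set X | forall x, K x ->
    U (character_fun X x)].
Proof.
move=> cK nU.
have c0 : continuous ((fun=> 0) : G -> circle R) by move=> x; exact: cvg_cst.
have n0 := compact_open_near c0 cK nU.
have val_c := @initial_continuous dual _
  (\val : dual -> {compact-open, G -> circle R}).
have nX : nbhs (0 : dual) [set X | forall x, K x -> U (character_fun X x - 0)].
  exact: (val_c (0 : dual) _ n0).
by apply: filterS nX => X XK x Kx; have := XK x Kx; rewrite subr0.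
Qed.

(** With each value the image of [V] contains all its multiples, and the arc contains no nontrivial
    subgroup. *)
Lemma character_small V X : subgroup V ->
  (forall x, V x -> small_arc (character_fun X x)) -> annihilator V X.
Proof.
move=> sV XV x Vx; apply: no_small_subgroups => n.
by rewrite -(addfMn (@characterD _ _ X)); apply: XV; exact: subgroupMn.
Qed.

Lemma nbhs_small_arc : nbhs (0 : circle R) (@small_arc R).
Proof. by apply: open_nbhs_nbhs; split; [exact: small_arc_open|exact: small_arc0]. Qed.

Lemma annihilator_nbhs V : subgroup V -> compact V -> nbhs 0 (annihilator V).
Proof.
move=> sV cV; apply: filterS (nbhs_dual_compact cV nbhs_small_arc) => X.
exact: character_small.
Qed.

Lemma character_near X : nbhs 0 [set x | small_arc (character_fun X x)].
Proof.
have nX : nbhs (character_fun X 0) (@small_arc R).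
  by rewrite (addf0 (@characterD _ _ X)); exact: nbhs_small_arc.
exact: (@character_continuous R G X 0 _ nX).
Qed.

(* Otherwise some additive [h : G -> R] kills [V] and maps [x] to 1, and
   [t |-> circle_pi (t * h _)] is a path of characters. *)
Lemma totally_disconnected_dual_torsion V :
  totally_disconnected [set: dual] -> subgroup V -> nbhs 0 V ->
  forall x, exists2 m, (0 < m)%N & V (x *+ m).
Proof.
move=> td sV nV x; apply: contrapT => nm.
have Vk k : V (x *~ k) -> (1 : R) *~ k = 0.
  have [->|k0 Vxk] := eqVneq k 0; first by rewrite mulr0z.
  exfalso; apply: nm; exists `|k|%N; first by rewrite absz_gt0.
  have [kE|kE] : k = `|k|%N \/ k = - `|k|%N%:Z by lia.
    by rewrite pmulrn -kE.
  rewrite pmulrn (_ : _%:Z = - k); last by lia.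
  by rewrite mulrNz; exact: subgroupN.
have [h hD [hV hx]] := extend_by_zero (@real_divisible R) sV Vk.
have hc y : \forall z \near y, h z = h y.
  move/(nbhs_translate V y): nV; apply: filterS => z /= /hV.
  by rewrite (addfB hD) => /eqP; rewrite subr_eq0 => /eqP.
have pc t : exists X, character_fun X = (fun y => circle_pi (t * h y)).
  apply: character_exists => [|y z].
    apply: (morph_continuous_ker _ nV) => [y z|y /hV ->].
      by rewrite hD mulrDr circle_piD.
    by rewrite mulr0 circle_pi0.
  by rewrite hD mulrDr circle_piD.
pose p t := projT1 (cid (pc t)).
have pE t y : character_fun (p t) y = circle_pi (t * h y).
  by rewrite /p; case: cid => /= X ->.
(* Since [h] is constant near each point of [K], local control in [K] reduces to continuity of
   [s |-> circle_pi (s * h y)]. *)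
have cp : continuous p.
  move=> t; apply: cvg_dual => K O cK oO KO.
  have : near_covering K by exact/compact_near_coveringP.
  move=> /(_ R (nbhs t) (fun s y => O (character_fun (p s) y))) near_K.
  suff : \forall s \near t, K `<=` (fun y => O (character_fun (p s) y)).
    by apply: filterS => s sK _ [y Ky <-]; exact: sK.
  apply: near_K => y Ky.
  have : \forall s \near t, O (circle_pi (s * h y)).
    have : {for t, continuous (fun s : R => circle_pi (s * h y))}.
      apply: (@continuous_comp _ _ _ (fun s : R => s * h y) (@circle_pi R)).
        by apply: cvgMl; exact: cvg_id.
      exact: circle_pi_continuous.
    by apply; apply: open_nbhs_nbhs; split => //; apply: KO; exists y.
  move=> nO; exists ([set z | h z = h y], [set s | O (circle_pi (s * h y))]).
    by split => //; exact: hc.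
  by move=> [z s] /= [hz Os]; rewrite pE hz.
have conn : connected (p @` [set: R]).
  apply: connected_continuous_connected; last exact: continuous_subspaceT.
  by apply/connected_intervalP => ? ? ? ?.
have p0 : p 0 = 0.
  by apply: character_fun_inj; apply/funext => y; rewrite pE mul0r circle_pi0.
(* The parameter 1/2 is chosen because [h x = 1]: the character reached there takes at [x] the
   nonzero value [circle_pi 2^-1]. *)
have : connected_component [set: dual] 0 (p 2^-1).
  by apply: (connected_component_max _ _ conn); [exists 0|by []|exists 2^-1].
rewrite (td 0)// => p2; have := pE 2^-1 x.
rewrite p2 character0E hx mulr1 => /esym/circle_pi_eq0/intrP[k k2].
have k0 : (0 < k) by rewrite -(ltr_int R) -k2; lra.
have k1 : (k < 1) by rewrite -(ltr_int R) -k2; lra.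
by lia.
Qed.

End characters.

(** * Compact open subgroups *)

(** Compactness in its near-covering form, along the filter of finite sequences directed by
    inclusion: the points of [y + V] are covered as soon as the sequence contains [y]. *)
Lemma finite_translates (G : topologicalZmodType) (K V : set G) :
  compact K -> nbhs 0 V ->
  exists s : seq G, forall y, K y -> exists2 c, c \in s & V (y - c).
Proof.
move=> /compact_near_coveringP cK nV.
pose F : set_system (seq G) := filter_from setT
  (fun s : seq G => [set s' : seq G | {subset s <= s'}]).
have FF : Filter F.
  apply: filter_from_filter; first by exists [::].
  move=> s s' _ _; exists (s ++ s') => // r sr.
  by split=> x xs; apply: sr; rewrite mem_cat xs ?orbT.
have : \forall s \near F, K `<=` (fun y => exists2 c, c \in s & V (y - c)).
  apply: cK => y Ky; exists ([set z | V (z - y)], [set s : seq G | y \in s]).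
    split; first by apply/nbhs_translate.
    by exists [:: y] => // s; apply; rewrite mem_head.
  by move=> [z s] /= [Vzy ys]; exists y.
by move=> [s _ /(_ s (fun _ => id)) sK]; exists s.
Qed.

Section van_dantzig.
Context (G : topologicalZmodType).
Hypothesis G_td : totally_disconnected [set: G].

Section clopen_neighborhoods.
Context (K : set G) (cK : compact K) (clK : closed K) (K0 : K 0).

Definition clopen_in (C : set G) := [/\ C 0, C `<=` K, closed C & closed (K `\` C)].

(** The quasicomponent of 0 in [K]. *)
Let Q := \bigcap_(C in clopen_in) C.

Lemma clopen_inT : clopen_in K.
Proof. by split=> //; rewrite setDv; exact: closed0. Qed.

Lemma clopen_inI C D : clopen_in C -> clopen_in D -> clopen_in (C `&` D).
Proof.
move=> [C0 CK cC cC'] [D0 DK cD cD']; split => //.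
- by move=> x [/CK].
- exact: closedI.
- by rewrite setDIr; exact: closedU.
Qed.

(** Each point of [L] is avoided by some relatively clopen set; these sets are stable under finite
    intersections, so by compactness a single one avoids all of [L]. *)
Lemma clopen_in_avoid (L : set G) : compact L -> L `&` Q = set0 ->
  exists2 C, clopen_in C & C `&` L = set0.
Proof.
move=> /compact_near_coveringP cL LQ.
pose F : set_system (set G) := filter_from clopen_in (fun C => [set D | D `<=` C]).
have FF : Filter F.
  apply: filter_from_filter; first by exists K; exact: clopen_inT.
  move=> C D /clopen_inI /[apply] CD; exists (C `&` D) => // E /= ECD.
  by split=> x /ECD [].
have : \forall C \near F, L `<=` (fun y => ~ C y).
  apply: cL => y Ly.
  have [C cC nCy] : exists2 C, clopen_in C & ~ C y.
    apply: contrapT => nC; have : (L `&` Q) y; last by rewrite LQ.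
    by split => // C cC; apply: contrapT => nCy; apply: nC; exists C.
  exists (~` C, [set D | D `<=` C]); last by move=> [z D] /= [nCz DC] /DC.
  split; last by exists C.
  by apply: open_nbhs_nbhs; split => //; apply: closed_openC; case: cC.
move=> [C cC /(_ C (fun _ => id)) CL]; exists C => //; rewrite -subset0 => x [Cx Lx].
exact: CL Cx.
Qed.

(** Quasicomponents of a compact set are connected. The tube lemma for [id] gives a [V] for which
    the thickenings [U E] and [U E'] are disjoint; some clopen [C] lies in their union, so its part
    in [U E] is clopen again and contains [Q], which leaves no room for [E']. *)
Lemma clopen_in_quasicomponent (E E' : set G) : closed E -> closed E' ->
  E `&` E' = set0 -> E `|` E' = Q -> E 0 -> E' = set0.
Proof.
move=> cE cE' EE' EQ E0.
have QK : Q `<=` K by move=> x /(_ _ clopen_inT).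
have cptE : compact E by apply: (subclosed_compact cE cK) => x Ex; apply: QK;
  rewrite -EQ; left.
have cid : continuous (id : G -> G) by move=> x; exact: cvg_id.
have := compact_open_tube cid cptE (closed_openC cE').
have EE'0 : id @` E `<=` ~` E'.
  by move=> _ [x Ex <-] E'x; have : (E `&` E') x by []; rewrite EE'.
move=> /(_ EE'0) /nbhs0_sub[V [oV V0 Vsub]].
pose U (A : set G) := \bigcup_(a in A) [set x | V (x - a)].
have oU A : open (U A) by apply: bigcup_open => a _; exact: open_subl.
have UA A : A `<=` U A by move=> a Aa; exists a => //=; rewrite subrr.
have UU : U E `&` U E' = set0.
  rewrite -subset0 => x [[a Ea /= Vxa] [b E'b /= Vxb]].
  by have /= := Vsub _ _ Vxa Vxb a Ea; rewrite opprB addrA [a + _]addrC subrK addrC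
    subrK.
have [||C [C0 CK cC cC'] CL] := clopen_in_avoid (L := K `\` (U E `|` U E')).
- apply: (subclosed_compact _ cK); last by move=> x [].
  by apply: closedI => //; apply: open_closedC; exact: openU.
- rewrite -subset0 => x [[Kx nU]]; rewrite -EQ => -[Ex|E'x]; apply: nU.
    by left; exact: UA.
  by right; exact: UA.
have CU : C `<=` U E `|` U E'.
  move=> x Cx; apply: contrapT => nU; have : (C `&` (K `\` (U E `|` U E'))) x.
    by split => //; split => //; exact: CK.
  by rewrite CL.
have : clopen_in (C `&` U E).
  split.
  - by split=> //; exact: UA.
  - by move=> x [/CK].
  - rewrite (_ : _ `&` _ = C `&` ~` (U E')); first by apply: closedI => //;
    exact: open_closedC.
    apply/seteqP; split=> x [Cx].
      by move=> Ux; split=> // U'x; have : (U E `&` U E') x by []; rewrite UU.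
    by move=> nU'; split => //; have [] := CU _ Cx.
  - rewrite setDIr; apply: closedU => //; apply: closedI => //.
    exact: open_closedC.
move=> cCU; rewrite -subset0 => x E'x.
have /(_ _ cCU)[_ Ux] : Q x by rewrite -EQ; right.
have : (U E `&` U E') x by split => //; exact: UA.
by rewrite UU.
Qed.

(** Connectedness of [Q] and total disconnectedness give [Q = {0}], so the part of [K] outside [W]
    is a compact set missing [Q]. *)
Lemma clopen_in_small (W : set G) : open W -> W 0 ->
  exists2 C, clopen_in C & C `<=` W.
Proof.
move=> oW W0; have Q0 : Q 0 by move=> C [].
have cQ : closed Q by apply: closed_bigI => C [].
have Qconn : connected Q.
  move=> B [b Bb] [U oU BU] [D cD BD].
  have cB : closed B by rewrite BD; exact: closedI.
  have cB' : closed (Q `&` ~` U) by apply: closedI => //; exact: open_closedC.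
  have BB' : B `&` (Q `&` ~` U) = set0.
    by rewrite -subset0 => x [+ [_]]; rewrite BU => -[].
  have BQ : B `|` (Q `&` ~` U) = Q by rewrite BU -setIUr setUv setIT.
  have [B0|nB0] := pselect (B 0).
    by rewrite -[RHS]BQ (clopen_in_quasicomponent cB cB' BB' BQ B0) setU0.
  have B'0 : (Q `&` ~` U) 0 by move: Q0; rewrite -{1}BQ => -[].
  have B0 : B = set0.
      by apply: (clopen_in_quasicomponent cB' cB _ _ B'0);
        [rewrite setIC|rewrite setUC].
  by move: Bb; rewrite B0.
have Q1 : Q `<=` [set 0].
  by rewrite -(G_td (x := 0))//; exact: connected_component_max.
have [||C cC CL] := clopen_in_avoid (L := K `\` W).
- apply: (subclosed_compact _ cK); last by move=> x [].
  by apply: closedI => //; exact: open_closedC.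
- by rewrite -subset0 => x [[_ nW] /Q1 /= x0]; apply: nW; rewrite x0.
exists C => // x Cx; apply: contrapT => nW; have : (C `&` (K `\` W)) x.
  by split => //; split=> //; case: cC => _ + _ _; apply.
by rewrite CL.
Qed.

End clopen_neighborhoods.

Hypothesis G_lc : locally_compact [set: G].

Definition compact_open_subgroup (V : set G) :=
  [/\ subgroup V, compact V & nbhs 0 V].

Lemma van_dantzig (N : set G) : nbhs 0 N ->
  exists2 V, compact_open_subgroup V & V `<=` N.
Proof.
move=> nN; have [K nK] : exists2 K : set G, nbhs 0 K & compact K /\ closed K.
  have [K nK KP] := G_lc (x := 0) I; exists K => //.
  have {}nK : nbhs (0 : G) [set x | [set: G] x -> K x] by exact: nK.
  by apply: filterS nK => x /(_ I).
move=> [cK clK].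
have K0 : K 0 by exact: nbhs_singleton.
(* A subset of the interior of [K] that is relatively open in [K] is open in [G]; hence the
   intersection with the interior. *)
have [||C [C0 CK cC cC'] CW] := clopen_in_small cK clK K0 (W := K° `&` N°).
- by apply: openI; exact: open_interior.
- by split.
have oC : open C.
  rewrite (_ : C = (K° `&` N°) `&` ~` (K `\` C)).
    by apply: openI; [apply: openI; exact: open_interior|exact: closed_openC].
  apply/seteqP; split=> x; first by move=> Cx; split; [exact: CW|move=> []].
  move=> [[Kx _] nKC]; apply: contrapT => nCx; apply: nKC; split => //.
  exact: interior_subset.
have cptC : compact C by exact: (subclosed_compact cC cK).
have cid : continuous (id : G -> G) by move=> x; exact: cvg_id.
have nS : nbhs 0 [set v | forall c, C c -> C (c + v)].
  by apply: (compact_open_tube cid cptC oC) => _ [x Cx <-].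
(* The stabilizer of the compact open set [C]. *)
pose V := [set v | forall c, C c -> C (c + v) /\ C (c - v)].
have sV : subgroup V.
  split=> [c Cc|x y Vx Vy c Cc]; first by rewrite subr0 addr0.
  split; first by rewrite addrA; apply: (Vy _ _).2; exact: (Vx _ Cc).1.
  by rewrite opprB addrA; apply: (Vx _ _).2; exact: (Vy _ Cc).1.
have nV : nbhs 0 V.
  have nS' : nbhs (0 : G) [set v | forall c, C c -> C (c - v)].
    have := @opp_continuous G 0 [set v | forall c, C c -> C (c + v)].
    by rewrite oppr0 => /(_ nS).
  by apply: filterS (filterI nS nS') => v [Sv S'v] c Cc; split; [exact: Sv|exact: S'v].
have VC : V `<=` C by move=> v /(_ 0 C0)[]; rewrite add0r.
exists V; last by move=> v /VC/CW[_]; exact: interior_subset.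
by split=> //; apply: (subclosed_compact _ cptC VC); exact: closed_subgroup.
Qed.

End van_dantzig.

(** * Pontryagin duality *)

Section annihilators.
Context (R : realType) (G : topologicalZmodType).
Local Notation dual := (pontryagin_dual R G).
Implicit Types (V : set G) (X Y : dual).

(** The homomorphisms killing [V] form a closed subset [P] of a product of circles, compact by
    Tychonoff's theorem. They are constant on cosets of [V], so on [P] pointwise convergence already
    implies compact-open convergence, and [h] is continuous. *)
Lemma annihilator_compact V : nbhs 0 V -> compact (annihilator V : set dual).
Proof.
move=> nV.
pose T := prod_topology (fun _ : G => circle R).
pose P : set T := [set f | {morph (f : G -> circle R) : x y / x + y} /\
  forall x, V x -> f x = 0].
have cP : compact P.
  have := @tychonoff G (fun _ => circle R) (fun _ => setT) (fun _ => @compact_circle R).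
  move=> cT; apply: (subclosed_compact _ cT) => //.
  have evc x : continuous (fun f : T => f x) by exact: proj_continuous.
  rewrite (_ : P = (\bigcap_(p in [set: G * G]) [set f | f (p.1 + p.2) - f p.1 - f
    p.2 = 0])
    `&` \bigcap_(x in V) [set f | f x = 0]); last first.
    apply/seteqP; split=> f [fD fV]; split=> //.
      by move=> p _ /=; rewrite fD [f p.1 + _]addrC addrK subrr.
    move=> x y; have /eqP := fD (x, y) I.
    by rewrite -addrA -opprD subr_eq0 => /eqP.
  apply: closedI; [apply: closed_bigI => p _|apply: closed_bigI => x _].
    pose g := fun f : T => f (p.1 + p.2) - f p.1 - f p.2.
    have cg : continuous g.
      apply: (@continuous_subf _ _ (fun f : T => f (p.1 + p.2) - f p.1) (fun f : T =>
        f p.2)) => //.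
      by apply: (@continuous_subf _ _ (fun f : T => f (p.1 + p.2)) (fun f : T =>
        f p.1)).
    exact: (@closed_comp _ _ g _ (fun f _ => cg f) (@circle_closed0 R)).
  exact: (@closed_comp _ _ (fun f : T => f x) _ (fun f _ =>
    evc x f) (@circle_closed0 R)).
have mk f : exists X, P f -> character_fun X = f.
  have [[fD fV]|nP] := pselect (P f); last by exists 0.
  have [X XE] := character_exists (morph_continuous_ker fD nV fV) fD.
  by exists X.
pose h f := projT1 (cid (mk f)).
have hE f : P f -> character_fun (h f) = f by rewrite /h; case: cid.
rewrite (_ : annihilator V = h @` P); last first.
  apply/seteqP; split=> [X XV|_ [f Pf <-] x Vx]; last first.
    by rewrite hE//; apply: Pf.2.
  have PX : P (character_fun X) by split => //; exact: characterD.
  by exists (character_fun X) => //; apply: character_fun_inj; rewrite hE.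
apply: continuous_compact cP; apply/subspace_continuousP => f Pf.
apply: cvg_dual => K O cK oO KO.
have : near_covering K by exact/compact_near_coveringP.
move=> /(_ T (within P (nbhs f)) (fun g y => O (character_fun (h g) y))) near_K.
suff : \forall g \near within P (nbhs f), K `<=` (fun y => O (character_fun (h g) y)).
  by apply: filterS => g gK _ [y Ky <-]; exact: gK.
apply: near_K => y Ky.
(* Every [g] in [P] takes the value [g y] throughout [y + V], so a condition at the single point [y]
   suffices. *)
exists ([set z | V (z - y)], [set g | P g /\ O (g y)]).
  split => /=; first by apply/nbhs_translate.
  have nO : nbhs f [set g : T | O (g y)].
    apply: (@proj_continuous _ _ y); apply: open_nbhs_nbhs; split => //.
    by apply: KO; exists y => //; rewrite hE.
  by apply: filterS nO => g Og Pg.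
move=> [z g] /= [Vzy [Pg Og]]; rewrite hE//.
have [gD gV] := Pg; have /eqP := gV _ Vzy.
by rewrite (addfB gD) subr_eq0 => /eqP ->.
Qed.

Context (G_torsion : forall V x, subgroup V -> nbhs 0 V ->
  exists2 m, (0 < m)%N & V (x *+ m)).

Lemma torsion_multiple V x : subgroup V -> nbhs 0 V ->
  exists2 m, (0 < m)%N & forall k, V (x *~ k) <-> (m %| k)%Z.
Proof.
move=> sV nV; have ex : exists m, (0 < m)%N && `[< V (x *+ m) >].
  by have [m m0 Vm] := G_torsion x sV nV; exists m; rewrite m0; apply/asboolP.
case: (ex_minnP ex) => m /andP[m0 /asboolP Vm] mmin; exists m => // k.
split=> [Vk|/dvdzP[q ->]]; last by rewrite mulrC mulrzA -pmulrn; exact: subgroupMz.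
have m0z : (0 : int) < m by rewrite ltz_nat.
rewrite /dvdz; apply/dvdz_mod0P.
have := modz_ge0 k (lt0r_neq0 m0z); have := ltz_pmod k m0z.
have kE := divz_eq k m; case: (modz k m) kE => // r kE rm _.
have Vr : V (x *+ r).
  have := subgroupB sV Vk (subgroupMz sV (k %/ m)%Z Vm).
  by rewrite pmulrn -mulrzA mulrC -mulrzBr {1}kE addrAC subrr add0r -pmulrn.
apply/eqP; rewrite eqz_nat -leqn0 leqNgt; apply/negP => r0.
have : (m <= r)%N by apply: mmin; rewrite r0; apply/asboolP.
by rewrite leqNgt => /negP; apply; rewrite -ltz_nat.
Qed.

(** If [m] is the order of [x] modulo [V], some character kills [V] and takes the value [1 / m] at
    [x]; its vanishing there forces [m = 1]. *)
Lemma annihilator_separates V x : subgroup V -> nbhs 0 V ->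
  (forall X, annihilator V X -> character_fun X x = 0) -> V x.
Proof.
move=> sV nV Xx; have [m m0 Vm] := torsion_multiple x sV nV.
have [k|g gD [gV gx]] := @extend_by_zero G (circle R) (@circle_divisible R) V x (frac
  R 1 m) sV.
  move=> /Vm/dvdzP[q ->]; rewrite mulrC mulrzA -pmulrn frac_natmul mul1n fracNN//.
  by rewrite mul0rz.
have [X XE] := character_exists (morph_continuous_ker gD nV gV) gD.
have := Xx X; rewrite /annihilator /= XE => /(_ gV); rewrite gx => /eqP.
rewrite -(frac0 R m) => /eqP/frac_eq; rewrite mod0n => /(_ m0)/eqP.
by rewrite -/(_ %| _)%N dvdn1 => /eqP m1; have := (Vm 1).2; rewrite m1; apply.
Qed.

(* The values at [c] of the characters killing [V] and [s] form a finite cyclic group;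
   the value of [f] at a character attaining a generator gives the multiple of [c]
   to be subtracted. *)
Lemma finite_evaluation V (s : seq G) (f : dual -> circle R) :
  subgroup V -> nbhs 0 V -> {morph f : X Y / X + Y} ->
  (forall X, annihilator V X -> (forall c, c \in s -> character_fun X c = 0) ->
     f X = 0) ->
  exists x, forall X, annihilator V X -> f X = character_fun X x.
Proof.
move=> sV nV; elim: s f => [|c s IH] f fD fs.
  exists 0 => X XV; rewrite (addf0 (@characterD _ _ X)); exact: fs.
have [M M0 VM] := G_torsion c sV nV.
pose A X := annihilator V X /\ forall c, c \in s -> character_fun X c = 0.
have sA : subgroup [set X | A X].
  split; first by split => [|? _]; [exact: (subgroup0 (annihilator_subgroup _ _))|].
  move=> X Y [XV Xs] [YV Ys]; split; first exact: (subgroupB (annihilator_subgroup _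
    _)).
  by move=> d ds; rewrite (addfB (eval_morph d)) Xs// Ys// subrr.
have exk : exists k, (0 < k)%N && `[< exists2 X, A X &
  character_fun X c = frac R k M >].
  exists M; rewrite M0; apply/asboolP; exists 0; first exact: (subgroup0 sA).
  by rewrite fracNN.
case: (ex_minnP exk) => k /andP[k0 /asboolP[X0 AX0 X0c]] kmin.
have mult l X : A X -> character_fun X c = frac R l M -> (k %| l)%N.
  move=> AX Xc; rewrite /dvdn; apply/negPn; rewrite -lt0n; apply/negP => r0.
  have := ltn_pmod l k0; rewrite ltnNge => /negP[]; apply: kmin.
  rewrite r0; apply/asboolP.
  exists (X - X0 *+ (l %/ k)).
    by apply: (subgroupB sA) => //; exact: (subgroupMn sA).
  rewrite (addfB (eval_morph c)) (addfMn (eval_morph c)) X0c Xc frac_natmul.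
  by rewrite {1}(divn_eq l k) fracD mulnC addrAC subrr add0r.
have [q ME] : exists q, M = (k * q)%N.
  have := mult M 0 (subgroup0 sA); rewrite fracNN// => /(_ erefl)/dvdnP[q ->].
  by exists q; rewrite mulnC.
have q0 : (0 < q)%N by move: M0; rewrite ME muln_gt0 => /andP[].
(* The character [X0 *+ q] also vanishes at [c], since its value there is [(k * q) / M]. So [f X0]
   is killed by [q], and [j / q = (k * j) / M] is the value of [X0] at [c *+ j]. *)
have [j _ fX0] : exists2 j, (j < q)%N & f X0 = frac R j q.
  apply: circle_torsion => //; rewrite -(addfMn fD); apply: fs.
    exact: (subgroupMn sA q AX0).1.
  move=> d; rewrite inE => /orP[/eqP ->|ds]; last exact: (subgroupMn sA q AX0).2.
  by rewrite (addfMn (eval_morph c)) X0c frac_natmul -ME fracNN.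
have fX0E : f X0 = character_fun X0 (c *+ j).
  by rewrite (addfMn (@characterD _ _ X0)) X0c frac_natmul fX0 ME [(k * q)%N]mulnC
    [(k * j)%N]mulnC fracM.
have [|X AX Xs|x xP] := IH (fun X => f X - character_fun X (c *+ j)).
- by move=> X Y; rewrite fD characterDE opprD addrACA.
- have AX' : A X by [].
  have [l _ Xc] : exists2 l, (l < M)%N & character_fun X c = frac R l M.
    apply: circle_torsion => //; rewrite -(addfMn (@characterD _ _ X)); exact: AX.
  have /dvdnP[p lE] := mult _ _ AX' Xc.
  have pX : f (X - X0 *+ p) = 0.
    have AXp : A (X - X0 *+ p) by apply: (subgroupB sA) => //; exact: (subgroupMn sA).
    apply: fs; first exact: AXp.1.
    move=> d; rewrite inE => /orP[/eqP ->|ds]; last exact: AXp.2.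
    rewrite (addfB (eval_morph c)) (addfMn (eval_morph c)) X0c Xc frac_natmul.
    by rewrite lE mulnC subrr.
  move/eqP: pX; rewrite (addfB fD) subr_eq0 => /eqP ->.
  rewrite (addfMn fD) fX0E -(addfMn (eval_morph (c *+ j))).
  rewrite -(addfB (eval_morph (c *+ j))) (addfMn (@characterD _ _ _)).
  rewrite (addfB (eval_morph c)) (addfMn (eval_morph c)) X0c Xc lE frac_natmul.
  by rewrite mulnC subrr mul0rn.
exists (x + c *+ j) => X AX; rewrite characterD -(xP X AX) subrK//.
Qed.

End annihilators.

Section biduality.
Context (R : realType) (G : topologicalZmodType).
Local Notation dual := (pontryagin_dual R G).
Local Notation bidual := (pontryagin_dual R dual).
Hypotheses (G_td : totally_disconnected [set: G])
  (G_lc : locally_compact [set: G])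
  (dual_td : totally_disconnected [set: dual]).

Let G_torsion V x (sV : subgroup V) (nV : nbhs 0 V) :
  exists2 m, (0 < m)%N & V (x *+ m) :=
  totally_disconnected_dual_torsion dual_td sV nV x.

Let base := van_dantzig G_td G_lc.

Lemma annihilator_exists (X : dual) (N : set G) : nbhs 0 N ->
  exists2 V, compact_open_subgroup V /\ V `<=` N & annihilator V X.
Proof.
move=> nN; have [V cV VX] := base (filterI nN (character_near X)).
exists V; first by split => // x /VX[].
by apply: character_small => [|x /VX[]]; first by case: cV.
Qed.

Lemma evaluation_exists x :
  exists xi : bidual, forall X, character_fun xi X = character_fun X x.
Proof.
have c : continuous (fun X : dual => character_fun X x).
  apply: morph_continuous => [|U nU]; first exact: eval_morph.
  have n := nbhs_dual_compact (@compact_set1 G x) nU.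
  by apply: filterS n => X /(_ x erefl).
by have [xi E] := character_exists c (eval_morph x); exists xi => X; rewrite E.
Qed.

Lemma evaluation_surjective (xi : bidual) :
  exists x, forall X, character_fun xi X = character_fun X x.
Proof.
have xiD := characterD xi.
have [K cK Kxi] := nbhs_dual (character_near xi).
have xiK X : annihilator K X -> character_fun xi X = 0.
  by apply: character_small => //; exact: annihilator_subgroup.
(* The candidates for [x] modulo [V]: two elements of [Y V] differ by an element of [V], because
   characters separate points from [V]. *)
pose Y V := [set x | forall X, annihilator V X ->
  character_fun xi X = character_fun X x].
have Y0 V : compact_open_subgroup V -> Y V !=set0.
  move=> [sV cV nV]; have [s sK] := finite_translates cK nV.
  apply: (finite_evaluation G_torsion (s := s)) => // X XV Xs.
  apply: xiK => y /sK[c cs /XV] /eqP.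
  by rewrite (addfB (@characterD _ _ X)) subr_eq0 (Xs _ cs) => /eqP.
have [V0 cosV0 _] := base filterT; have [sV0 cV0 nV0] := cosV0.
have [x0 Yx0] := Y0 _ cosV0.
pose D := [set V | compact_open_subgroup V /\ V `<=` V0].
pose F := filter_from D Y.
have FF : ProperFilter F.
  apply: filter_from_proper => [|V [cV _]]; last exact: Y0.
  apply: filter_from_filter; first by exists V0; split.
  move=> V W [[sV cV nV] VV0] [[sW cW nW] WV0]; exists (V `&` W).
    split; last by move=> x [/VV0].
    split; last exact: filterI.
      split=> [|x y [Vx Wx] [Vy Wy]]; first by split; exact: subgroup0.
      by split; exact: subgroupB.
    by apply: compact_closedI => //; exact: closed_subgroup.
  by move=> x Yx; split=> X Xa; apply: Yx => y [? ?]; exact: Xa.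
have FY V : D V -> F (Y V) by move=> DV; exists V.
have cC : compact ((fun v => x0 + v) @` V0).
  apply: continuous_compact => //; apply: continuous_subspaceT => v.
  apply: (@continuous_comp _ _ _ (fun v : G => (x0, v)) (fun p : G * G => p.1 + p.2)).
    by apply: cvg_pair => /=; [exact: cvg_cst|exact: cvg_id].
  exact: add_continuous.
(* The filter lives on the compact coset [x0 + V0], which contains [Y V0]; this yields a cluster
   point. *)
have FC : F ((fun v => x0 + v) @` V0).
  have DV0 : D V0 by split.
  apply: filterS (FY V0 DV0) => x Yx; exists (x - x0); last by rewrite addrC subrK.
  apply: (annihilator_separates (R := R) G_torsion) => // X XV.
  by rewrite (addfB (@characterD _ _ X)) -Yx// -Yx0// subrr.
have [x [_ xF]] := cC F FF FC; exists x => X.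
have [V [cosV VV0] XV] := annihilator_exists X nV0.
have [sV cV nV] := cosV.
(* The cluster point [x] need not be known to lie in [Y V]: it is within [V] of an element [y] of
   [Y V], and [X] does not distinguish the two. *)
have [y [Yy /= Vyx]] := xF _ _ (FY V (conj cosV VV0)) ((nbhs_translate V x).1 nV).
rewrite Yy//; have /eqP := XV _ Vyx.
by rewrite (addfB (@characterD _ _ X)) subr_eq0 => /eqP.
Qed.

Lemma biduality : exists2 e : G -> bidual,
  homeomorphism e & {morph e : x y / x + y}.
Proof.
pose e x := projT1 (cid (evaluation_exists x)).
have eE x X : character_fun (e x) X = character_fun X x by rewrite /e; case: cid.
have eD : {morph e : x y / x + y}.
  move=> x y; apply: character_fun_inj; apply/funext => X.
  by rewrite characterDE !eE characterD.
have small (V : set G) : compact_open_subgroup V ->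
    forall x, annihilator (annihilator V) (e x) -> V x.
  move=> [sV cV nV] x xV; apply: (annihilator_separates (R := R) G_torsion) => // X XV.
  by rewrite -eE; apply: xV.
(* Points are connected components and hence closed, so an element in every neighbourhood of 0 is
   0. *)
have T1 (x : G) : (forall N : set G, nbhs 0 N -> N x) -> x = 0.
  move=> xN; have := G_td (x := 0) I => Q0.
  have c0 : closed [set (0 : G)].
    by rewrite -Q0; apply: component_closed; exact: closedT.
  apply: contrapT => x0; have n : nbhs (0 : G) [set y | y + x != 0].
    apply/(nbhs_shift (fun y => y != 0)).
    have : nbhs x (~` [set 0]) by apply: open_nbhs_nbhs; split; [exact: closed_openC|].
    by apply: filterS => y /eqP.
  have n' := @opp_continuous G 0 [set y | y + x != 0].
  by move: n'; rewrite oppr0 => /(_ n)/xN /=; rewrite addNr eqxx.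
have injE x : e x = 0 -> x = 0.
  move=> ex; apply: T1 => N /base[V cV]; apply; apply: small => // X _.
  by rewrite ex.
have surjE xi : exists x, e x = xi.
  have [x xE] := evaluation_surjective xi; exists x.
  by apply: character_fun_inj; apply/funext => X; rewrite eE xE.
pose g xi := projT1 (cid (surjE xi)).
have gK : cancel g e by move=> xi; rewrite /g; case: cid.
have eK : cancel e g.
  by move=> x; apply/eqP; rewrite -subr_eq0; apply/eqP/injE;
    rewrite (addfB eD) gK subrr.
exists e => //; exists g; split => //.
  (* Continuity of [e]. Each [X] in the compact set [C] kills some compact open [V], and so do all
     characters in the open coset of [annihilator V] around [X]; compactness of [C] makes this
     uniform. *)
  apply: morph_continuous => // N /nbhs_dual[C cC CN].
  suff : \forall x \near (0 : G), C `<=` (fun X => character_fun X x = 0).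
    by apply: filterS => x xC; apply: CN => X /xC; rewrite eE.
  have : near_covering C by exact/compact_near_coveringP.
  move=> /(_ G (nbhs 0) (fun x X => character_fun X x = 0)); apply=> X CX.
  have [V [[sV cV nV] _] XV] := annihilator_exists X filterT.
  exists ([set Y | annihilator V (Y - X)], V) => /=.
    by split=> //; apply/nbhs_translate; exact: annihilator_nbhs.
  move=> [Y x] /= [YX Vx]; have /eqP := YX _ Vx.
  by rewrite (addfB (eval_morph x)) XV// subr0 => /eqP.
(* Continuity of the inverse: [annihilator V] is a compact subgroup of the dual, so its own
   annihilator is a neighbourhood of 0 in the bidual, and by [small] it comes from [V]. *)
apply: morph_continuous => [xi eta|N /base[V cV VN]].
  by apply: (can_inj eK); rewrite eD !gK.
have [sV cptV nV] := cV.
have := annihilator_nbhs R (@annihilator_subgroup R G V) (@annihilator_compact R G V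
  nV).
by apply: filterS => xi xiV; apply: VN; apply: small => //; rewrite gK.
Qed.

End biduality.

(** * Presentations in terms of codes *)

Local Open Scope nat_scope.

(* From level [j] down to level [j - d]; meaningful for [d <= j] only. *)
Fixpoint descend (F : nat -> nat -> nat) (j d x : nat) : nat :=
  if d is d'.+1 then F (j - d) (descend F j d' x) else x.

Lemma descend_top F j d x : descend F j.+1 d.+1 x = descend F j d (F j x).
Proof.
elim: d => [|d IH]; first by rewrite /= subSS subn0.
by rewrite [LHS]/= -[F _ (descend _ _ _ _)]/(descend F j.+1 d.+1 x) IH subSS.
Qed.

Local Open Scope ring_scope.

(* [Q i x] is the code of the image of [x] in the [i]-th finite-kernel quotient:
   the groups and bonding maps of a presentation are replaced by [Q] and by
   number-theoretic functions acting on codes. *)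
Record complete_tower (H : topologicalZmodType) (Q : nat -> H -> nat) : Prop := {
  tower_mul : exists2 mul, computable3 mul &
    forall i x y, mul i (Q i x) (Q i y) = Q i (x + y);
  tower_inv : exists2 inv, computable2 inv &
    forall i x, inv i (Q i x) = Q i (- x);
  tower_one : computable1 (fun i => Q i 0);
  tower_dom : computable2 (fun i n => `[< range (Q i) n >] : nat);
  tower_map : exists2 F, computable2 F & forall i x, F i (Q i.+1 x) = Q i x;
  tower_ker : exists2 k, computable1 k & forall i,
    strong_index_set (k i) = Q i.+1 @` [set x | Q i x = Q i 0];
  tower_nbhs : forall i, nbhs 0 [set x | Q i x = Q i 0];
  tower_base : forall N, nbhs 0 N -> exists i, [set x | Q i x = Q i 0] `<=` N;
  tower_complete : forall x : nat -> H, (forall i, Q i (x i.+1) = Q i (x i)) ->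
    exists y, forall i, Q i y = Q i (x i);
  tower_separated : forall x, (forall i, Q i x = Q i 0) -> x = 0 }.

Section discrete_product.
Context (A : nat -> choiceType).
Let P := prod_topology (fun i => discrete_topology (A i)).

Lemma cvg_prod_discrete (F : set_system P) (g : P) : Filter F ->
  (forall i, F [set s | s i = g i]) -> F --> g.
Proof.
move=> FF Fg; apply/cvg_sup => i U [V] [[W] oW <-] Wg WU.
by apply: (filterS WU); apply: filterS (Fg i) => s /= ->.
Qed.

Lemma nbhs_prod_discrete (g : P) i : nbhs g [set s : P | s i = g i].
Proof.
have := @proj_continuous nat (fun i => discrete_topology (A i)) i g [set g i].
by apply; exact: (@discrete_set1 (discrete_topology (A i))).
Qed.
End discrete_product.

(** * From a presentation to a tower of codes *)

Section presentation_tower.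
Context (H : topologicalZmodType) (A : nat -> groupType)
  (phi : forall i, {multiplicative A i.+1 -> A i}) (code : forall i, A i -> nat).
Context (f : H -> inverse_limit phi) (f_homeo : homeomorphism f)
  (fD : forall (x y : H) (i : nat),
      \val (f (x + y)) i = (\val (f x) i * \val (f y) i)%g).
Hypothesis phi_surj : forall i (y : A i), exists x, phi i x = y.
Hypothesis code_inj : forall i, injective (@code i).

Let Q i x := code (\val (f x) i).

Lemma limit_thread (s : nat -> nat) : (forall i, range (@code i) (s i)) ->
  (forall i (x : A i.+1), code x = s i.+1 -> code (phi i x) = s i) ->
  exists x, forall i, Q i x = s i.
Proof.
move=> srange sphi.
pose t i : A i := projT1 (cid2 (srange i)).
have tE i : code (t i) = s i by rewrite /t; case: cid2.
have tl : inverse_limit phi t.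
  by move=> i; apply: (@code_inj i); rewrite tE (sphi _ _ (tE _)).
have [g [_ gK _ _]] := f_homeo.
exists (g (exist (fun u => u \in inverse_limit phi) _ (mem_set tl))) => i.
by rewrite /Q gK /= tE.
Qed.

Lemma limit_val x i : phi i (\val (f x) i.+1) = \val (f x) i.
Proof. by have := set_valP (f x); exact. Qed.

(** Above level [i] the element is lifted step by step through the surjections, below it is pushed
    down. The thread is built from codes, whose type does not depend on the level; this avoids casts
    between the groups. *)
Lemma limit_surjective i (a : A i) : exists x, \val (f x) i = a.
Proof.
have ex_map : exists F : nat -> nat -> nat, forall i (x : A i.+1), F i (code x) =
  code (phi i x).
  have FE j n : exists m, forall x : A j.+1, code x = n -> m = code (phi j x).
    have [[x <-]|nx] := pselect (exists x : A j.+1, code x = n).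
      by exists (code (phi j x)) => y /code_inj ->.
    by exists 0%N => x xn; case: nx; exists x.
  exists (fun j n => projT1 (cid (FE j n))) => j x.
  by case: cid => m /= /(_ x erefl).
have [F FE] := ex_map.
have lift n : exists L : nat -> nat, forall y, range (@code n) y ->
    range (@code n.+1) (L y) /\ F n (L y) = y.
  have LE y : exists z, range (@code n) y -> range (@code n.+1) z /\ F n z = y.
    have [[b _ <-]|nb] := pselect (range (@code n) y); last by exists 0%N.
    by have [c cb] := phi_surj b; exists (code c) => _; rewrite FE cb; split=> //;
      exists c.
  by exists (fun y => projT1 (cid (LE y))) => y; case: cid.
pose L n := projT1 (cid (lift n)).
have LP n y : range (@code n) y -> range (@code n.+1) (L n y) /\ F n (L n y) = y.
  by rewrite /L; case: cid => l /= /(_ y).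
pose up := fix up n := if n is n'.+1 then L (i + n')%N (up n') else code a.
have upR n : range (@code (i + n)%N) (up n).
  elim: n => [|n IH] /=; first by rewrite addn0; exists a.
  by rewrite addnS; exact: (LP _ _ IH).1.
have upF n : F (i + n)%N (up n.+1) = up n by exact: (LP _ _ (upR n)).2.
have downR d : forall j x, (d <= j)%N -> range (@code j) x ->
    range (@code (j - d)%N) (descend F j d x).
  elim: d => [|d IH] j x dj jx; first by rewrite subn0.
  have := IH j x (ltnW dj) jx; have -> : (j - d)%N = (j - d.+1).+1 by lia.
  by move=> [y _ /= <-]; rewrite FE; exists (phi _ y).
(* Going up [m] levels from [i] and then down [i] levels lands at level [m]: one formula for the
   levels on both sides of [i]. *)
have [|j x xs|x xE] := @limit_thread (fun m => descend F (i + m) i (up m)).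
- by move=> m; have := downR i (i + m)%N _ (leq_addr _ _) (upR m); rewrite addKn.
- rewrite -FE xs addnS -[in RHS](upF j) -descend_top /=.
  by rewrite subSS addKn.
exists x; apply: (@code_inj i); rewrite -/(Q i x) xE.
suff upD n : descend F (i + n) n (up n) = code a by exact: upD.
elim: n => [|n IH]; first by [].
by rewrite addnS descend_top upF.
Qed.

Lemma code_eq i x y : Q i x = Q i y <-> \val (f x) i = \val (f y) i.
Proof. by rewrite /Q; split=> [/code_inj|->]. Qed.

Lemma limit_val0 i : \val (f 0) i = 1%g.
Proof.
have := fD 0 0 i; rewrite addr0 => /(congr1 (fun u => (\val (f 0) i)^-1 * u)%g).
by rewrite mulVg mulKg.
Qed.

Lemma limit_valN i x : \val (f (- x)) i = (\val (f x) i)^-1%g.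
Proof.
rewrite -[LHS]mulg1 -(mulgV (\val (f x) i)) mulgA -fD addNr limit_val0.
by rewrite mul1g.
Qed.

Lemma limit_val_le (x y : inverse_limit phi) i j : (i <= j)%N ->
  \val x j = \val y j -> \val x i = \val y i.
Proof.
move=> /subnKC <-; elim: (j - i)%N => [|d IH]; first by rewrite addn0.
by rewrite addnS => xy; apply: IH; rewrite -(set_valP x) xy (set_valP y).
Qed.

Lemma range_code_tower i : range (@code i) = range (Q i).
Proof.
apply/seteqP; split=> _ [x _ <-]; last by exists (\val (f x) i).
by have [y <-] := limit_surjective x; exists y.
Qed.

Lemma presentation_complete_tower :
  uniformly_computable_groups code -> uniformly_computable_maps phi code ->
  computable_kernels phi code -> complete_tower Q.
Proof.
move=> [_ dom one [inv inv_c invE] [mul mul_c mulE]] [F F_c FE] [k k_c kE].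
have [g [fK gK f_cont g_cont]] := f_homeo.
split.
- by exists mul => // i x y; rewrite mulE /Q fD.
- by exists inv => // i x; rewrite invE /Q limit_valN.
- by apply: rec_ext one => t; rewrite /Q limit_val0.
- by apply: rec_ext dom => t; rewrite range_code_tower.
- by exists F => // i x; rewrite FE /Q limit_val.
- exists k => // i; rewrite kE; apply/seteqP; split=> [_ [a /= a1 <-]|_ [x /= x0 <-]].
    have [x xa] := limit_surjective a; exists x; last by rewrite /Q xa.
    by apply/code_eq; rewrite limit_val0 -limit_val xa.
  exists (\val (f x) i.+1) => //=; rewrite /bonding_kernel /= limit_val.
  by move/code_eq: x0; rewrite limit_val0.
- move=> i; have n := nbhs_prod_discrete (A := fun i => A i) (\val (f 0)) i.
  have n' := @initial_continuous (inverse_limit phi) _ \val (f 0) _ n.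
  have {}n' : nbhs (0 : H) [set x | \val (f x) i = \val (f 0) i].
    exact: (f_cont 0 _ n').
  by apply: filterS n' => x /= /code_eq.
- move=> N nN; have gN : nbhs (f 0) (g @^-1` N) by apply: g_cont; rewrite fK.
  have [_ [[B oB <-] B0 BN]] := gN.
  (* These sets generate a filter converging to [f 0] in the product, so one of them lies in the
     open set [B]. *)
  pose Fi i := [set s | inverse_limit phi s /\ s i = \val (f 0) i].
  have FF : Filter (filter_from setT Fi).
    apply: filter_from_filter; first by exists 0%N.
    move=> i j _ _; exists (maxn i j) => // s [sl sE].
    have sE' := @limit_val_le (exist (fun u =>
      u \in inverse_limit phi) _ (mem_set sl)) (f 0).
    by split; split => //; apply: (sE' _ (maxn i j)); rewrite ?leq_maxl ?leq_maxr.
  have := @cvg_prod_discrete A _ (\val (f 0)) FF.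
  move=> /(_ (fun i => ex_intro2 _ _ i I (fun s => @proj2 _ _))) /(_ B).
  case; first exact: open_nbhs_nbhs.
  move=> i _ iB; exists i => x /= /code_eq xE.
  by rewrite -(fK x); apply: BN; apply: iB; split => //; exact: set_valP.
- move=> x xE; have [|i a ax|y yE] := @limit_thread (fun i => Q i (x i)).
  + by move=> i; exists (\val (f (x i)) i).
  + by move: ax => /code_inj ->; rewrite limit_val -xE.
  + by exists y.
- move=> x xE; rewrite -(fK x) -(fK 0); congr g; apply: val_inj.
  by apply: functional_extensionality_dep => i; apply/code_eq.
Qed.

End presentation_tower.

(** * From a tower of codes back to a presentation *)

Section tower_presentation.
Context (H : topologicalZmodType) (Q : nat -> H -> nat) (tQ : complete_tower Q).

Lemma tower_eq i x y : Q i x = Q i y <-> Q i (x - y) = Q i 0.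
Proof.
have [mul _ mulE] := tower_mul tQ; split=> xy.
  by rewrite -mulE xy mulE subrr.
by rewrite -(subrK y x) -mulE xy mulE add0r.
Qed.

Lemma tower_eqD i x x' y y' : Q i x = Q i x' -> Q i y = Q i y' ->
  Q i (x + y) = Q i (x' + y').
Proof. by have [mul _ mulE] := tower_mul tQ => xx yy; rewrite -!mulE xx yy. Qed.

Lemma tower_eqN i x x' : Q i x = Q i x' -> Q i (- x) = Q i (- x').
Proof. by have [inv _ invE] := tower_inv tQ => xx; rewrite -!invE xx. Qed.

Lemma tower_eqS i x y : Q i.+1 x = Q i.+1 y -> Q i x = Q i y.
Proof. by have [F _ FE] := tower_map tQ => xx; rewrite -(FE i x) xx FE. Qed.

Lemma tower_eq_le i j x y : (i <= j)%N -> Q j x = Q j y -> Q i x = Q i y.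
Proof.
move=> /subnKC <-; elim: (j - i)%N => [|d IH]; first by rewrite addn0.
by rewrite addnS => xy; apply: IH; exact: tower_eqS xy.
Qed.

Lemma tower_subgroup i : subgroup [set x | Q i x = Q i 0].
Proof.
split=> // x y /= x0 y0; rewrite -[in RHS](subrr (0 : H)).
by apply: tower_eqD => //; apply: tower_eqN.
Qed.

(** The quotient of [H] is rebuilt on its set of codes, so that the inclusion [val] is the
    coding. *)
Definition tower_level i := {n : nat | `[< range (Q i) n >]}.

Definition level_proj i (x : H) : tower_level i :=
  exist _ (Q i x) (asboolT (ex_intro2 _ _ x I erefl)).

Definition level_repr i (a : tower_level i) : H :=
  projT1 (cid2 (asboolW (valP a))).

Lemma level_reprK i : cancel (@level_repr i) (level_proj i).
Proof. by move=> a; apply: val_inj; rewrite /level_repr /=; case: cid2. Qed.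

Lemma level_projK i x : Q i (level_repr (level_proj i x)) = Q i x.
Proof. exact: (congr1 val (level_reprK (level_proj i x))). Qed.

Lemma level_proj_eq i x y : level_proj i x = level_proj i y <-> Q i x = Q i y.
Proof. by split=> [/(congr1 val)|xy]; last exact: val_inj. Qed.

Definition level_mul i (a b : tower_level i) :=
  level_proj i (level_repr a + level_repr b).
Definition level_inv i (a : tower_level i) := level_proj i (- level_repr a).

Lemma level_projD i x y :
  level_proj i (x + y) = level_mul (level_proj i x) (level_proj i y).
Proof. by apply/level_proj_eq; apply: tower_eqD; rewrite level_projK. Qed.

Lemma level_projN i x : level_proj i (- x) = level_inv (level_proj i x).
Proof. by apply/level_proj_eq; apply: tower_eqN; rewrite level_projK. Qed.

Lemma level_ind i (P : tower_level i -> Prop) :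
  (forall x, P (level_proj i x)) -> forall a, P a.
Proof. by move=> Px a; rewrite -(level_reprK a). Qed.

Lemma level_mulA i : associative (@level_mul i).
Proof.
by do 3!elim/level_ind => ?; rewrite -!level_projD addrA.
Qed.
Lemma level_mul1 i : left_id (level_proj i 0) (@level_mul i).
Proof. by elim/level_ind => ?; rewrite -!level_projD add0r. Qed.
Lemma level_mulr1 i : right_id (level_proj i 0) (@level_mul i).
Proof. by elim/level_ind => ?; rewrite -!level_projD addr0. Qed.
Lemma level_mulV i : left_inverse (level_proj i 0) (@level_inv i) (@level_mul i).
Proof. by elim/level_ind => ?; rewrite -level_projN -!level_projD addNr. Qed.
Lemma level_mulrV i : right_inverse (level_proj i 0) (@level_inv i) (@level_mul i).
Proof. by elim/level_ind => ?; rewrite -level_projN -!level_projD addrN. Qed.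

HB.instance Definition _ i := Choice.on (tower_level i).
HB.instance Definition _ i := isGroup.Build (tower_level i)
  (@level_mulA i) (@level_mul1 i) (@level_mulr1 i) (@level_mulV i) (@level_mulrV i).

Definition level_map i (a : tower_level i.+1) : tower_level i :=
  level_proj i (level_repr a).

Lemma level_map_proj i x : level_map (level_proj i.+1 x) = level_proj i x.
Proof. by apply/level_proj_eq/tower_eqS; rewrite level_projK. Qed.

Lemma level_map_mul i : {morph @level_map i : x y / (x * y)%g}.
Proof.
elim/level_ind => x; elim/level_ind => y.
by rewrite -[(_ * _)%g]level_projD !level_map_proj level_projD.
Qed.

HB.instance Definition _ i :=
  isMultiplicative.Build (tower_level i.+1) (tower_level i) (@level_map i)
    (@level_map_mul i).

Lemma tower_isomorphic : isomorphic_to_inverse_limit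
  (fun i => @level_map i : {multiplicative tower_level i.+1 -> tower_level i}) H.
Proof.
set phi := fun i => _ : {multiplicative tower_level i.+1 -> tower_level i}.
have fl x : inverse_limit phi (fun i => level_proj i x).
  by move=> i; exact: level_map_proj.
pose f x : inverse_limit phi := exist (fun u =>
  u \in inverse_limit phi) _ (mem_set (fl x)).
have gex (s : inverse_limit phi) : exists y, forall i, level_proj i y = \val s i.
  have [|y yE] := tower_complete tQ (x := fun i => level_repr (\val s i)).
    move=> i; apply/(level_proj_eq i); rewrite level_reprK -(set_valP s i).
    by [].
  by exists y => i; rewrite -[RHS]level_reprK; apply/level_proj_eq.
pose g s := projT1 (cid (gex s)).
have gE s i : level_proj i (g s) = \val s i by rewrite /g; case: cid.
exists f; split; last by move=> x y i; exact: level_projD.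
exists g; split.
- move=> x; apply/eqP; rewrite -subr_eq0; apply/eqP; apply: (tower_separated tQ) => i.
  by apply: (tower_eq i _ _).1; apply/level_proj_eq; rewrite gE.
- by move=> s; apply: val_inj; apply: functional_extensionality_dep => i; exact: gE.
- apply: continuous_comp_initial => x.
  apply: (@cvg_prod_discrete tower_level) => i.
  have n := (nbhs_translate _ x).1 (tower_nbhs tQ i).
  have : nbhs x [set y | level_proj i y = level_proj i x]; last by [].
  by apply: filterS n => y /= /(tower_eq i _ _).2/level_proj_eq.
- move=> s N /nbhs_shift/(tower_base tQ)[i iN].
  have n := nbhs_prod_discrete (A := tower_level) (\val s) i.
  have {}n : nbhs s [set t | \val t i = \val s i].
    exact: (@initial_continuous (inverse_limit phi) _ \val s _ n).
  have : nbhs s (g @^-1` N); last by [].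
  apply: filterS n => t /= ti; rewrite -(subrK (g s) (g t)).
  by apply: iN; apply: (tower_eq i _ _).1; apply/level_proj_eq; rewrite !gE.
Qed.

(** If [u <= n] then [u < 2 ^ n] and the bit is zero. This is what lets quantifiers over a coded set
    be bounded by its code. *)
Lemma strong_index_set_lt u n : strong_index_set u n -> (n < u)%N.
Proof.
rewrite /strong_index_set /=; apply: contraTltn => un.
by rewrite divn_small// (leq_ltn_trans un)// ltn_expl.
Qed.

Lemma complete_tower_presentation : has_computable_tdlc_presentation H.
Proof.
exists (fun i => tower_level i : groupType),
  (fun i => @level_map i : {multiplicative tower_level i.+1 -> tower_level i}),
  (fun i (a : tower_level i) => val a).
have QK i (a : tower_level i) : exists x, a = level_proj i x.
  by exists (level_repr a); rewrite level_reprK.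
have range_val i : range (fun a : tower_level i => val a) = range (Q i).
  apply/seteqP; split=> _ [a _ <-]; first exact: asboolW (valP a).
  by exists (level_proj i a).
have ker : exists2 k, computable1 k & forall i,
    strong_index_set (k i) = (fun a : tower_level i.+1 => val a) @`
      [set a | level_map a = 1%g].
  have [k k_c kE] := tower_ker tQ; exists k => // j.
  rewrite kE; apply/seteqP; split=> [_ [x /= x0 <-]|_ [a /= + <-]].
    exists (level_proj _ x) => //=; rewrite level_map_proj.
    exact/level_proj_eq.
  have [x ->] := QK _ a; rewrite level_map_proj => /level_proj_eq x0.
  by exists x.
split.
- by move=> i a; have [x ->] := QK i a; exists (level_proj _ x); exact: level_map_proj.
- exact: tower_isomorphic.
- split.
    split.
    + by move=> i; exact: val_inj.
    + by apply: rec_ext (tower_dom tQ) => t; rewrite range_val.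
    + by apply: rec_ext (tower_one tQ).
    + have [inv inv_c invE] := tower_inv tQ; exists inv => // i a.
      by have [x ->] := QK i a; rewrite invE -[(_^-1)%g]level_projN.
    + have [mul mul_c mulE] := tower_mul tQ; exists mul => // i a b.
      have [x ->] := QK i a; have [y ->] := QK i b.
      by rewrite mulE -[(_ * _)%g]level_projD.
  have [F F_c FE] := tower_map tQ; exists F => // i a.
  by have [x ->] := QK i.+1 a; rewrite FE; exact: (congr1 val (esym (level_map_proj i
    x))).
- move=> i; have [k _ kE] := ker.
  have : finite_set ((fun a : tower_level i.+1 => val a) @^-1` `I_(k i)).
    by apply: finite_preimage; [move=> x y _ _; exact: val_inj|exact: finite_II].
  apply: sub_finite_set => a a1; apply: strong_index_set_lt.
  by rewrite kE; exists a.
- exact: ker.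
Qed.

End tower_presentation.

Lemma presentation_tower (H : topologicalZmodType) :
  has_computable_tdlc_presentation H -> exists Q : nat -> H -> nat, complete_tower Q.
Proof.
move=> [A [phi [code [surj [f [f_homeo fD]] [groups maps] _ kernels]]]].
exists (fun i x => code i (\val (f x) i)).
by apply: presentation_complete_tower => //; case: groups.
Qed.

Lemma complete_tower_comp (H H' : topologicalZmodType) (Q : nat -> H -> nat)
    (e : H' -> H) : homeomorphism e -> {morph e : x y / x + y} ->
  complete_tower Q -> complete_tower (fun i x => Q i (e x)).
Proof.
move=> [d [eK dK e_cont d_cont]] eD tQ.
have rangeE i : range (fun x => Q i (e x)) = range (Q i).
  apply/seteqP; split=> _ [x _ <-]; first by exists (e x).
  by exists (d x); rewrite ?dK.
split.
- by have [mul mul_c mulE] := tower_mul tQ; exists mul => // i x y; rewrite mulE eD.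
- by have [inv inv_c invE] := tower_inv tQ; exists inv => // i x; rewrite invE addfN.
- by apply: rec_ext (tower_one tQ) => t; rewrite addf0.
- by apply: rec_ext (tower_dom tQ) => t; rewrite rangeE.
- by have [F F_c FE] := tower_map tQ; exists F.
- have [k k_c kE] := tower_ker tQ; exists k => // i; rewrite kE addf0//.
  apply/seteqP; split=> _ [x /= x0 <-]; last by exists (e x).
  by exists (d x); rewrite /= dK.
- move=> i; rewrite addf0//; have n : nbhs (e 0) [set x | Q i x = Q i 0].
    by rewrite addf0//; exact: tower_nbhs.
  exact: (e_cont 0 _ n).
- move=> N nN; have n : nbhs 0 (d @^-1` N).
    by apply: d_cont; rewrite -(addf0 eD) eK.
  have [i iN] := tower_base tQ n; exists i => x; rewrite /= addf0// => /iN /=.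
  by rewrite eK.
- move=> x xE; have [y yE] := tower_complete tQ xE; exists (d y) => i.
  by rewrite dK.
- move=> x; rewrite addf0// => /(tower_separated tQ) ex.
  by rewrite -(eK x) ex -(addf0 eD) eK.
Qed.

(** * Finite subsets of a tower *)

Local Open Scope nat_scope.

(** Used in base 2 for strong indices, and in base [S!] for tables of character values, where the
    bound on [u] will matter. *)
Lemma digits_exist N M (v : nat -> nat) : 0 < N -> (forall x, x < M -> v x < N) ->
  exists2 u, u < N ^ M & forall x, (u %/ N ^ x) %% N = if x < M then v x else 0.
Proof.
move=> N0; elim: M => [|M IH] vN.
  by exists 0 => // x; rewrite div0n mod0n.
have [|u uM uv] := IH; first by move=> x xM; apply: vN; rewrite ltnS ltnW.
have vM : v M < N by exact: vN.
have uvM : v M * N ^ M + u < N ^ M.+1.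
  by rewrite expnS (@leq_trans ((v M).+1 * N ^ M))// ?leq_mul2r ?vM ?orbT// mulSn
    addnC ltn_add2r.
exists (v M * N ^ M + u) => // x; have [xM|xM|->] := ltngtP x M.
- rewrite ltnS ltnW// -(subnK (ltnW xM)) expnD mulnA divnMDl ?expn_gt0 ?N0//.
  rewrite subnK 1?ltnW// -(subnSK xM) expnS mulnCA -modnDml modnMr add0n uv xM.
  by [].
- by rewrite ltnS leqNgt xM divn_small ?mod0n// (leq_trans uvM)// leq_pexp2l.
- by rewrite ltnSn divnMDl ?expn_gt0 ?N0// divn_small// addn0 modn_small.
Qed.

Definition memn (u x : nat) := odd (u %/ 2 ^ x).

Lemma memn_lt u x : memn u x -> x < u.
Proof. exact: strong_index_set_lt. Qed.

Lemma memn_exist (s : seq nat) : exists u, forall x, memn u x = (x \in s).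
Proof.
have [|u _ uE] := @digits_exist 2 (\max_(x <- s) x).+1 (fun x => x \in s) isT.
  by move=> x _; case: (x \in s).
exists u => x; apply/idP/idP.
  rewrite /memn -[odd _]lt0b -modn2 uE; by case: ifP => // _; rewrite lt0b.
move=> xs; rewrite /memn -[odd _]lt0b -modn2 uE xs ltnS.
by rewrite (@leq_bigmax_seq _ s predT (fun x => x) x).
Qed.

Lemma memn_exist_set (A : set nat) : finite_set A ->
  exists u, forall x, memn u x <-> A x.
Proof.
move=> /finite_seqP[s ->]; have [u uE] := memn_exist s.
by exists u => x; rewrite uE.
Qed.

Lemma finite_memn u : finite_set [set x | memn u x].
Proof. by apply: (sub_finite_set _ (finite_II u)) => x /memn_lt. Qed.

Lemma rec_memn n (f g : n.-tuple nat -> nat) : recursive f -> recursive g ->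
  recursive (fun t => memn (f t) (g t) : nat).
Proof. by move=> rf rg; rewrite /memn; rec. Qed.
#[local] Hint Extern 1 (recursive (fun _ => nat_of_bool (memn _ _))) =>
  apply: rec_memn : recursive.

Lemma rec_descend F n (f g h : n.-tuple nat -> nat) : computable2 F ->
  recursive f -> recursive g -> recursive h ->
  recursive (fun t => descend F (f t) (g t) (h t)).
Proof.
move=> F_c rf rg rh; apply: (@rec_ext _ (fun t =>
  nat_rect (fun=> nat) (h t) (fun d r => F (f t - d.+1) r) (g t))).
  by move=> t; elim: (g t) => //= d ->.
by apply: (rec_nat_rect (g := fun d r t => F (f t - d.+1) r)); rec.
Qed.

Section tower_finite.
Context (H : topologicalZmodType) (Q : nat -> H -> nat) (tQ : complete_tower Q).
Context (mul : nat -> nat -> nat -> nat) (mul_c : computable3 mul)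
  (mulE : forall i x y, mul i (Q i x) (Q i y) = Q i (x + y)%R).
Context (F : nat -> nat -> nat) (F_c : computable2 F)
  (FE : forall i x, F i (Q i.+1 x) = Q i x).
Context (k : nat -> nat) (k_c : computable1 k)
  (kE : forall i, strong_index_set (k i) = Q i.+1 @` [set x | Q i x = Q i 0%R]).
Context (H_torsion : forall x, exists2 m, 0 < m & Q 0 (x *+ m)%R = Q 0 0%R).

Definition code_dom i n := `[< range (Q i) n >].

Lemma code_domP i n : reflect (exists x, Q i x = n) (code_dom i n).
Proof.
by apply: (iffP idP) => [/asboolW[x _ <-]|[x <-]]; [exists x|apply/asboolP; exists x].
Qed.

Lemma rec_code_dom n (f g : n.-tuple nat -> nat) : recursive f -> recursive g ->
  recursive (fun t => code_dom (f t) (g t) : nat).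
Proof. exact: (rec_comp2 (tower_dom tQ)). Qed.
#[local] Hint Extern 1 (recursive (fun _ => nat_of_bool (code_dom _ _))) =>
  apply: rec_code_dom : recursive.

Lemma rec_code_one n (f : n.-tuple nat -> nat) : recursive f ->
  recursive (fun t => Q (f t) 0%R).
Proof. exact: (rec_comp1 (tower_one tQ)). Qed.
#[local] Hint Extern 1 (recursive (fun _ => descend F _ _ _)) =>
  apply: (rec_descend F_c) : recursive.
#[local] Hint Extern 1 (recursive (fun _ => Q _ 0%R)) =>
  apply: rec_code_one : recursive.

Lemma kernelP i x : memn (k i) (Q i.+1 x) <-> Q i x = Q i 0%R.
Proof.
have -> : memn (k i) (Q i.+1 x) = strong_index_set (k i) (Q i.+1 x) :> Prop by [].
rewrite kE; split=> [[y /= y0 /(tower_eqS tQ) <-]//|x0]; by exists x.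
Qed.

Lemma descendE j d x : d <= j -> descend F j d (Q j x) = Q (j - d) x.
Proof.
elim: d j => [|d IH] j dj; first by rewrite subn0.
by rewrite -[j]prednK 1?(leq_ltn_trans _ dj)// descend_top FE IH ?subSS// -ltnS
  prednK// (leq_ltn_trans _ dj).
Qed.

(** Closure under addition is all that is tested: in a torsion group inverses are multiples. *)
Definition subgroup_code u := [&& memn u (Q 0 0%R),
  bounded_all u (fun x => memn u x ==> code_dom 0 x) &
  bounded_all u (fun x => bounded_all u (fun y =>
    memn u x && memn u y ==> memn u (mul 0 x y)))].

Lemma rec_subgroup_code n (f : n.-tuple nat -> nat) : recursive f ->
  recursive (fun t => subgroup_code (f t) : nat).
Proof. by move=> rf; rewrite /subgroup_code; rec. Qed.
#[local] Hint Extern 1 (recursive (fun _ => nat_of_bool (subgroup_code _))) =>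
  apply: rec_subgroup_code : recursive.

Definition level0 u : set H := [set h | memn u (Q 0 h)].

Lemma level0_congr u x y : Q 0 x = Q 0 y -> level0 u x -> level0 u y.
Proof. by rewrite /level0 /= => ->. Qed.

Lemma subgroup_codeP u : subgroup_code u <->
  subgroup (level0 u) /\ forall n, memn u n -> exists x, Q 0 x = n.
Proof.
split=> [/and3P[u0 /bounded_allP udom /bounded_allP umul]|[su udom]].
  have uD x y : level0 u x -> level0 u y -> level0 u (x + y)%R.
    rewrite /level0 /= -mulE => ux uy.
    have /bounded_allP/(_ _ (memn_lt uy)) := umul _ (memn_lt ux).
    by rewrite ux uy.
  split; last first.
    by move=> n un; apply/code_domP; apply: implyP (udom _ (memn_lt un)) un.
  split=> // x y ux uy; refine (uD _ _ ux _).
  have [m m0 ym] := H_torsion y.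
  have um j : level0 u (y *+ j)%R.
    elim: j => [|j IH]; first by rewrite mulr0n; exact: u0.
    by rewrite mulrS; exact: (uD _ _ uy IH).
  (* At level 0 the element [y *+ m.-1] agrees with [- y], because [y *+ m] agrees with 0. *)
  apply: level0_congr (um m.-1).
  by apply: (tower_eq tQ 0 _ _).2; rewrite opprK -mulrSr prednK.
apply/and3P; split; first exact: subgroup0 su.
  by apply/bounded_allP => n _; apply/implyP => /udom ?; exact/code_domP.
apply/bounded_allP => a _; apply/bounded_allP => b _; apply/implyP => /andP[ua ub].
have [x xa] := udom _ ua; have [y yb] := udom _ ub.
rewrite -xa -yb mulE; apply: (subgroupD su); by rewrite /level0 /= ?xa ?yb.
Qed.

Definition extend_code v n u :=
  [&& subgroup_code u, bounded_all v (fun x => memn v x ==> memn u x) &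
      code_dom 0 n ==> memn u n].

(** Adjoining an element [x] of order dividing [m] to a finite group keeps it finite: the sums
    [y + x *+ j] with [j < m] suffice. *)
Lemma extend_code_exist v n : subgroup_code v -> exists u, extend_code v n u.
Proof.
move=> cv; have /subgroup_codeP[sv vdom] := cv.
have [/code_domP[x <-{n}]|nn] := boolP (code_dom 0 n); last first.
  by exists v; rewrite /extend_code cv (negbTE nn) andbT /=; apply/bounded_allP =>
    y _; apply/implyP.
have [m m0 xm] := H_torsion x.
pose A := [set p | exists2 y, level0 v y & exists2 j, j < m & p = Q 0 (y + x *+ j)%R].
have finA : finite_set A.
  pose lift a := xget 0%R [set y | Q 0 y = a].
  apply: (@sub_finite_set _ _ ((fun p => mul 0 p.1 (Q 0 (x *+ p.2)%R)) @`
     ([set a | memn v a] `*` `I_m))); last first.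
    by apply: finite_image; apply: finite_setX => //; exact: finite_memn.
  by move=> _ [y vy [j jm ->]]; exists (Q 0 y, j) => //=; rewrite mulE.
have [u uE] := memn_exist_set finA.
have uV y j : level0 v y -> level0 u (y + x *+ j)%R.
  move=> vy; apply/uE; exists y => //; exists (j %% m); first by rewrite ltn_mod.
  rewrite {1}(divn_eq j m) mulrnDr addrCA mulnC mulrnA; have sK := tower_subgroup tQ 0.
  have xq : Q 0 (x *+ m *+ (j %/ m))%R = Q 0 0%R by exact: (subgroupMn sK _ xm).
  by rewrite -[LHS]mulE xq mulE add0r.
have cu : subgroup_code u.
  apply/subgroup_codeP; split; last by move=> a /uE[y _ [j _ ->]]; eexists.
  split; first by have := uV 0%R 0 (subgroup0 sv); rewrite mulr0n addr0.
  move=> a b /uE[y vy [j jm ya]] /uE[z vz [l lm zb]].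
  (* Natural multiples only: [j + (m - l)] replaces [j - l], from which it differs by [m]. *)
  have := uV (y - z)%R (j + (m - l)) (subgroupB sv vy vz); rewrite /level0 /=.
  rewrite (tower_eqD tQ ya (tower_eqN tQ zb)) opprD addrACA.
  have -> : (y - z + x *+ (j + (m - l)) = y - z + (x *+ j - x *+ l) + x *+ m)%R.
    by rewrite mulrnDr mulrnBr 1?ltnW// -!addrA; congr (_ + (_ + (_ + _)))%R;
      rewrite addrC.
  by rewrite -[Q 0 (_ + x *+ m)%R]mulE xm mulE addr0.
exists u; apply/and3P; split => //.
  apply/bounded_allP => a _; apply/implyP => va; have [y ya] := vdom _ va.
  have : level0 v y by rewrite /level0 /= ya.
  by move=> /(uV _ 0); rewrite mulr0n addr0 /level0 /= ya.
by apply/implyP => _; have := uV 0%R 1 (subgroup0 sv); rewrite add0r.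
Qed.

Lemma subgroup_code_exist : exists u, subgroup_code u.
Proof.
have [u uE] := memn_exist [:: Q 0 0%R]; exists u; apply/subgroup_codeP.
split; last by move=> n; rewrite uE inE => /eqP ->; exists 0%R.
have -> : level0 u = [set x | Q 0 x = Q 0 0%R].
  by apply/seteqP; split=> x; rewrite /level0 /= uE inE => /eqP.
exact: tower_subgroup.
Qed.

(* Strong index of a finite subgroup of the bottom quotient containing all codes [< n]. *)
Definition bottom n : nat := nat_rect (fun=> nat) (search true subgroup_code)
  (fun n v => search (subgroup_code v) (extend_code v n)) n.

Lemma rec_bottom n (f : n.-tuple nat -> nat) : recursive f ->
  recursive (fun t => bottom (f t)).
Proof.
move=> rf; apply: (rec_nat_rect (f := fun=> search true subgroup_code)
  (g := fun n v _ => search (subgroup_code v) (extend_code v n))) => //.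
  by rec.
refine (@rec_search n.+2 (fun t : n.+2.-tuple nat =>
  subgroup_code (thead (behead_tuple t)))
  (fun u (t : n.+2.-tuple nat) => extend_code (thead (behead_tuple t)) (thead t) u) _
    _ _).
- by move=> t; exact: extend_code_exist.
- by rec.
- by rewrite /extend_code; rec.
Qed.
#[local] Hint Extern 1 (recursive (fun _ => bottom _)) =>
  apply: rec_bottom : recursive.

Lemma bottom_subgroup n : subgroup_code (bottom n).
Proof.
elim: n => [|n IH] /=; first by have [] := @searchP true _ (fun _ =>
  subgroup_code_exist) isT.
by have [/and3P[]] := @searchP _ _ (@extend_code_exist _ n) IH.
Qed.

Lemma bottomS n : extend_code (bottom n) n (bottom n.+1).
Proof. by have [] := @searchP _ _ (@extend_code_exist _ n) (bottom_subgroup n). Qed.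

Definition filtration n := level0 (bottom n).

Lemma filtration_subgroup n : subgroup (filtration n).
Proof. by have /subgroup_codeP[] := bottom_subgroup n. Qed.

Lemma filtrationS n : filtration n `<=` filtration n.+1.
Proof.
have /and3P[_ /bounded_allP bS _] := bottomS n; move=> x bx.
exact: implyP (bS _ (memn_lt bx)) bx.
Qed.

Lemma filtration_le m n : m <= n -> filtration m `<=` filtration n.
Proof.
move=> /subnKC <-; elim: (n - m) => [|d IH]; first by rewrite addn0.
by rewrite addnS => x /IH; exact: filtrationS.
Qed.

Lemma filtration_exhaust x : filtration (Q 0 x).+1 x.
Proof.
have /and3P[_ _ /implyP] := bottomS (Q 0 x); apply.
by apply/code_domP; exists x.
Qed.

Lemma filtration_ker n x : Q 0 x = Q 0 0%R -> filtration n x.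
Proof.
move=> x0; rewrite /filtration /level0 /= x0.
by have := subgroup0 (filtration_subgroup n).
Qed.

(** To be the full preimage of [v] is a condition on all codes. It is made bounded by asking that
    [u] map into [v], meet every fibre over [v], and be stable under the kernel, whose strong index
    [k i] is given. *)
Definition preimage_code i v u :=
  [&& bounded_all u (fun x => memn u x ==> code_dom i.+1 x && memn v (F i x)),
      bounded_all v (fun y => memn v y ==> bounded_ex u (fun x => memn u x &&
        (F i x == y))) &
      bounded_all u (fun x => bounded_all (k i) (fun z =>
        memn u x && memn (k i) z ==> memn u (mul i.+1 x z)))].

Definition dom_code i v := bounded_all v (fun y => memn v y ==> code_dom i y).

Lemma dom_codeP i v : reflect (forall y, memn v y ->
  exists x, Q i x = y) (dom_code i v).
Proof.
apply: (iffP (bounded_allP _ _)) => [vd y vy|vd y _].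
  by apply/code_domP; apply: implyP (vd _ (memn_lt vy)) vy.
by apply/implyP => /vd ?; apply/code_domP.
Qed.

Lemma preimage_codeP i v u : dom_code i v -> preimage_code i v u <->
  forall n, memn u n <-> exists2 x, memn v (Q i x) & Q i.+1 x = n.
Proof.
move=> /dom_codeP vd; split=> [/and3P[/bounded_allP u1 /bounded_allP u2 /bounded_allP
  u3] n|uE].
  split=> [un|[x vx <-]].
    have := implyP (u1 _ (memn_lt un)) un => /andP[/code_domP[x <-]].
    by rewrite FE; exists x.
  have /bounded_exP[a _ /andP[ua /eqP ax]] := implyP (u2 _ (memn_lt vx)) vx.
  have := implyP (u1 _ (memn_lt ua)) ua => /andP[/code_domP[y ya] _].
  have xy : memn (k i) (Q i.+1 (x - y)%R).
    by apply/kernelP; apply: (tower_eq tQ i _ _).1; rewrite -ax -ya FE.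
  have /bounded_allP/(_ _ (memn_lt xy)) := u3 _ (memn_lt ua).
  by rewrite ua xy -ya mulE addrC subrK.
apply/and3P; split.
- apply/bounded_allP => a _; apply/implyP => /uE[x vx <-]; rewrite FE vx andbT.
  by apply/code_domP; exists x.
- apply/bounded_allP => b _; apply/implyP => vb; have [x xb] := vd _ vb.
  have ux : memn u (Q i.+1 x) by apply/uE; exists x; rewrite ?xb.
  by apply/bounded_exP; exists (Q i.+1 x); [exact: memn_lt|rewrite ux FE xb /=].
- apply/bounded_allP => a _; apply/bounded_allP => z zk; apply/implyP =>
  /andP[/uE[x vx <-] kz].
  have : strong_index_set (k i) z by [].
  rewrite kE => -[y /= y0 <-]; rewrite mulE; apply/uE; exists (x + y)%R => //.
  by rewrite -mulE y0 mulE addr0.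
Qed.

(** Each fibre is a translate of the finite kernel: an element is the chosen lift of its image plus
    a kernel element. *)
Lemma preimage_finite i (A : set nat) : finite_set A ->
  finite_set [set n | exists2 x, A (Q i x) & Q i.+1 x = n].
Proof.
move=> finA; pose lift a := xget 0%R [set y | Q i y = a].
have liftE x : Q i (lift (Q i x)) = Q i x by rewrite /lift; case: xgetP => //= /(_ x).
apply: (@sub_finite_set _ _ ((fun p => mul i.+1 p.1 p.2) @`
  (((fun a => Q i.+1 (lift a)) @` A) `*` [set z | memn (k i) z]))).
  move=> _ [x Ax <-]; exists (Q i.+1 (lift (Q i x)), Q i.+1 (x - lift (Q i x))%R).
    split=> /=; first by exists (Q i x).
    by apply/kernelP; apply: (tower_eq tQ i _ _).1; rewrite liftE.
  by rewrite /= mulE addrC subrK.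
apply: finite_image; apply: finite_setX; first exact: finite_image.
exact: finite_memn.
Qed.

Lemma preimage_code_exist i v : dom_code i v -> exists u, preimage_code i v u.
Proof.
move=> vd; have [u uE] := memn_exist_set (preimage_finite i (finite_memn v)).
by exists u; apply/preimage_codeP.
Qed.

Definition layer n i : nat := nat_rect (fun=> nat) (bottom n)
  (fun i v => search (dom_code i v) (preimage_code i v)) i.

Lemma rec_layer n (f g : n.-tuple nat -> nat) : recursive f -> recursive g ->
  recursive (fun t => layer (f t) (g t)).
Proof.
move=> rf rg; apply: (rec_nat_rect (f := fun t => bottom (f t))
  (g := fun i v _ => search (dom_code i v) (preimage_code i v))) => //.
  exact: rec_bottom.
refine (@rec_search n.+2 (fun t : n.+2.-tuple nat =>
  dom_code (thead t) (thead (behead_tuple t)))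
  (fun u (t : n.+2.-tuple nat) => preimage_code (thead t) (thead (behead_tuple t)) u)
    _ _ _).
- by move=> t; exact: preimage_code_exist.
- by rewrite /dom_code; rec.
- by rewrite /preimage_code; rec.
Qed.
#[local] Hint Extern 1 (recursive (fun _ => layer _ _)) =>
  apply: rec_layer : recursive.

Lemma layerP n i a : memn (layer n i) a <-> exists2 x, filtration n x & Q i x = a.
Proof.
elim: i a => [|i IH] a.
  split=> [na|[x nx <-]//].
  by have /subgroup_codeP[_ /(_ _ na)[x xa]] := bottom_subgroup n; exists x;
    rewrite /filtration /level0 /= ?xa.
have vd : dom_code i (layer n i) by apply/dom_codeP => y /IH[x _ <-]; exists x.
have [+ _] := @searchP _ _ (@preimage_code_exist i _) vd.
move=> /(preimage_codeP _ vd)/(_ a) -> ; split=> -[x nx <-]; exists x => //.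
  have /IH[y ny yx] := nx; apply: level0_congr ny.
  exact: (tower_eq_le tQ (leq0n i) yx).
by apply/IH; exists x.
Qed.

Lemma layer_mem n i x : memn (layer n i) (Q i x) <-> filtration n x.
Proof.
split=> [/layerP[y ny yx]|nx]; last by apply/layerP; exists x.
by apply: level0_congr ny; exact: (tower_eq_le tQ (leq0n i) yx).
Qed.

(** As the limit of its finite layers, [filtration n] is the continuous image under decoding of a
    closed subset [P] of a product of finite sets. *)
Lemma filtration_compact n : compact (filtration n).
Proof.
pose T := prod_topology (fun _ : nat => discrete_topology nat).
pose P : set T := [set s | (forall i, memn (layer n i) (s i)) /\
  forall i, F i (s i.+1) = s i].
have cP : compact P.
  have := @tychonoff nat (fun=> discrete_topology nat)
    (fun i => [set a | memn (layer n i) a]) (fun i => finite_compact (finite_memn _)).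
  move=> cT; apply: (subclosed_compact _ cT); last by move=> s [].
  rewrite -[X in closed X]setCK; apply: open_closedC; rewrite openE => s nPs.
  have n1 i := nbhs_prod_discrete (A := fun _ : nat => nat) s i.
  have [[i nsi]|ns] := pselect (exists i, ~~ memn (layer n i) (s i)).
    by apply: filterS (n1 i) => t /= ti [/(_ i)]; rewrite ti (negbTE nsi).
  have [i nsi] : exists i, F i (s i.+1) <> s i.
    apply: contrapT => nF; apply: nPs; split=> i.
      by apply: contrapT => ?; apply: ns; exists i; exact/negP.
    by apply: contrapT => ?; apply: nF; exists i.
  by apply: filterS (filterI (n1 i) (n1 i.+1)) => t /= [ti ti1] [_ /(_ i)];
    rewrite ti ti1.
have decode (s : T) : exists x, P s -> forall i, Q i x = s i.
  have [[sl sF]|nP] := pselect (P s); last by exists 0%R.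
  have lx i : exists x, Q i x = s i by have /layerP[x _ xs] := sl i; exists x.
  pose x i := projT1 (cid (lx i)).
  have xE i : Q i (x i) = s i by rewrite /x; case: cid.
  have [i|y yE] := tower_complete tQ (x := x); last by exists y => _ i; rewrite yE.
  by rewrite -FE xE sF xE.
pose d s := projT1 (cid (decode s)).
have dE s i : P s -> Q i (d s) = s i by rewrite /d; case: cid => x /= /[apply].
have -> : filtration n = d @` P.
  apply/seteqP; split=> [x nx|_ [s Ps <-]].
    have Px : P (fun i => Q i x).
      by split=> i; rewrite ?FE//; apply/layer_mem.
    exists (fun i => Q i x) => //; apply/eqP; rewrite -GRing.subr_eq0; apply/eqP.
    by apply: (tower_separated tQ) => i; apply: (tower_eq tQ i _ _).1; rewrite dE.
  by apply: (layer_mem n 0 (d s)).1; rewrite dE//; exact: Ps.1.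
apply: continuous_compact cP; apply/subspace_continuousP => s Ps N.
move=> /nbhs_shift/(tower_base tQ)[i iN].
have n1 := nbhs_prod_discrete (A := fun _ : nat => nat) s i.
have : nbhs s [set t | P t -> N (d t)]; last by [].
apply: filterS n1 => t /= ti Pt; rewrite -(GRing.subrK (d s) (d t)).
by apply: iN; apply: (tower_eq tQ i _ _).1; rewrite !dE.
Qed.

(** * Codes of characters and the tower of the dual *)

Section character_codes.
Context (R : realType).
Local Notation dual := (pontryagin_dual R H).

(* The number [c = 2 ^ i * (2 * u).+1] codes the character of [filtration n] that factors
   through level [i] and whose value at the element with code [x] is the digit of rank
   [x] of [u] in base [N], divided by [N]; here [N = (layer n i)`!] is a multiple of
   the order of every element, since a set has fewer elements than its strong index. *)
Definition lev c := search true (fun i => (c == 0) || (c %% 2 ^ i.+1 != 0)).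
Definition pay c := c %/ 2 ^ (lev c).+1.

(** Every power of 2 divides 0; the disjunct gives it level 0, so that any number whatever can be
    decoded and tested. *)
Lemma lev_exist c : exists i, (c == 0) || (c %% 2 ^ i.+1 != 0).
Proof.
exists c; have [//|c0] := eqVneq c 0; rewrite modn_small//.
by rewrite (ltn_trans (ltn_expl c (leqnn 2)))// ltn_exp2l.
Qed.

Lemma rec_lev n (f : n.-tuple nat -> nat) : recursive f ->
  recursive (fun t => lev (f t)).
Proof.
move=> rf; refine (@rec_search n (fun=> true)
  (fun i (t : n.-tuple nat) => (f t == 0) || (f t %% 2 ^ i.+1 != 0)) _ _ _).
- by move=> t _; exact: lev_exist.
- exact: rec_const.
- by rec.
Qed.
#[local] Hint Extern 1 (recursive (fun _ => lev _)) =>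
  apply: rec_lev : recursive.

Lemma lev_pay i u : lev (2 ^ i * (2 * u).+1) = i /\ pay (2 ^ i * (2 * u).+1) = u.
Proof.
have E : 2 ^ i * (2 * u).+1 = u * 2 ^ i.+1 + 2 ^ i.
  by rewrite expnS; move: (2 ^ i) => p; nia.
have l : lev (2 ^ i * (2 * u).+1) = i.
  rewrite /lev; have [+ lmin] := @searchP true _ (fun _ =>
    lev_exist (2 ^ i * (2 * u).+1)) isT.
  set l := search _ _ => /orP[|ml]; first by rewrite muln_eq0 expn_eq0.
  apply/eqP; rewrite eqn_leq lmin; last first.
    rewrite E modnMDl modn_small ?ltn_exp2l// -lt0n expn_gt0 orbT//.
  rewrite andTb leqNgt; apply/negP => li; move/negP: ml; apply.
  by rewrite -/(_ %| _) dvdn_mulr// dvdn_exp2l.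
by split=> //; rewrite /pay l E divnMDl ?expn_gt0// divn_small ?addn0// ltn_exp2l.
Qed.

Definition den n c := (layer n (lev c))`!.
Definition digit n c x := (pay c %/ den n c ^ x) %% den n c.

Lemma den_gt0 n c : 0 < den n c. Proof. exact: fact_gt0. Qed.

Lemma rec_den n (f g : n.-tuple nat -> nat) : recursive f -> recursive g ->
  recursive (fun t => den (f t) (g t)).
Proof.
move=> rf rg; apply: rec_fact; apply: rec_layer => //; exact: rec_lev.
Qed.
#[local] Hint Extern 1 (recursive (fun _ => den _ _)) =>
  apply: rec_den : recursive.

Lemma rec_digit n (f g h : n.-tuple nat -> nat) :
  recursive f -> recursive g -> recursive h ->
  recursive (fun t => digit (f t) (g t) (h t)).
Proof.
move=> rf rg rh; have rl := rec_lev rg; have rd := rec_den rf rg.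
by rewrite /digit /pay; rec.
Qed.
#[local] Hint Extern 1 (recursive (fun _ => digit _ _ _)) =>
  apply: rec_digit : recursive.

Definition valid n c :=
  bounded_all (layer n (lev c)) (fun x => bounded_all (layer n (lev c)) (fun y =>
    memn (layer n (lev c)) x && memn (layer n (lev c)) y ==>
    (digit n c (mul (lev c) x y) == (digit n c x + digit n c y) %% den n c))).

Lemma rec_valid n (f g : n.-tuple nat -> nat) : recursive f -> recursive g ->
  recursive (fun t => valid (f t) (g t) : nat).
Proof. by move=> rf rg; rewrite /valid; rec. Qed.
#[local] Hint Extern 1 (recursive (fun _ => nat_of_bool (valid _ _))) =>
  apply: rec_valid : recursive.

Definition represents n c (X : dual) := forall h, filtration n h ->
  character_fun X h = frac R (digit n c (Q (lev c) h)) (den n c).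

Definition value n c (h : H) := frac R (digit n c (Q (lev c) h)) (den n c).

Lemma validP n c : valid n c <-> forall x y, filtration n x -> filtration n y ->
  value n c (x + y)%R = (value n c x + value n c y)%R.
Proof.
have dig x : digit n c x < den n c by rewrite ltn_mod den_gt0.
split=> [/bounded_allP v x y|v].
  move=> /(layer_mem n (lev c) x).2 nx /(layer_mem n (lev c) y).2 ny.
  have /bounded_allP/(_ _ (memn_lt ny)) := v _ (memn_lt nx).
  rewrite nx ny mulE => /eqP vE; rewrite /value vE frac_modn ?den_gt0//.
  exact: fracD.
apply/bounded_allP => a _; apply/bounded_allP => b _; apply/implyP.
move=> /andP[/layerP[x nx <-] /layerP[y ny <-]]; apply/eqP.
have := v _ _ nx ny; rewrite /value -fracD => /frac_eq; rewrite den_gt0.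
by move=> /(_ isT); rewrite mulE modn_small.
Qed.

(** An additive table is a homomorphism on [filtration n]. Divisibility of the circle extends it to
    [H], and the extension is continuous because it kills the open kernel of level [lev c]. *)
Lemma valid_represents n c : valid n c -> exists X, represents n c X.
Proof.
move=> /validP vD; have sF := filtration_subgroup n.
have v0 : value n c 0%R = 0%R.
  have F0 := subgroup0 sF; apply: (GRing.addrI (value n c 0%R)).
  by rewrite -vD// !addr0.
have vB x y : filtration n x -> filtration n y ->
    value n c (x - y)%R = (value n c x - value n c y)%R.
  move=> nx ny; rewrite -[X in (value n c X - _)%R](GRing.subrK y x) (vD (x - y)%R y)//.
    by rewrite GRing.addrK.
  exact: subgroupB.
have [|g gD gE] := @partial_morphism_extend H (circle R) (@circle_divisible R)
  [set p | filtration n p.1 /\ p.2 = value n c p.1].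
  split=> [|d [_ /=]]; last by rewrite v0.
  split=> [|a b [na a2] [nb b2]]; first by split; [exact: subgroup0|rewrite v0].
  by split; [exact: subgroupB|rewrite /= a2 b2 vB].
have gv x : filtration n x -> g x = value n c x by move=> nx; exact: gE.
have gc : continuous g.
  apply: (morph_continuous_ker gD (tower_nbhs tQ (lev c))) => x /= x0.
  have nx : filtration n x by apply: filtration_ker;
    exact: (tower_eq_le tQ (leq0n _) x0).
  by rewrite gv// /value x0.
by have [X XE] := character_exists gc gD; exists X => x nx; rewrite XE gv.
Qed.

Lemma represents_valid n c X : represents n c X -> valid n c.
Proof.
move=> XE; apply/validP => x y nx ny; rewrite /value -!XE ?characterD//.
by apply: subgroupD => //; exact: filtration_subgroup.
Qed.

(** Pigeonhole: the codes of the multiples [x *+ j] with [j <= S] all lie below [S], so two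
    coincide, and the difference of their ranks divides [S!]. *)
Lemma layer_fact n i x : filtration n x -> Q i (x *+ (layer n i)`!)%R = Q i 0%R.
Proof.
move=> nx; set S := layer n i.
have lt j : Q i (x *+ j)%R < S.
  apply: memn_lt; apply: (layer_mem n i _).2.
  exact: (subgroupMn (filtration_subgroup n) j nx).
have ninj : ~~ injectiveb (fun j : 'I_S.+1 => Ordinal (lt j)).
  apply/negP => /injectiveP inj; have := leq_card _ inj.
  by rewrite !card_ord ltnn.
have [a [b [ab Qab]]] : exists a b : 'I_S.+1, a < b /\ Q i (x *+ a)%R = Q i (x *+ b)%R.
  move/injectivePn: ninj => [a [b ab /(congr1 val)/= Qab]].
  have [lab|lba|/val_inj E] := ltngtP a b; first by exists a, b.
    by exists b, a.
  by rewrite E eqxx in ab.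
have Qd : Q i (x *+ (b - a))%R = Q i 0%R.
  by rewrite GRing.mulrnBr 1?ltnW//; apply: (tower_eq tQ i _ _).1.
have /dvdnP[q ->] : b - a %| S`!.
  by apply: dvdn_fact; rewrite subn_gt0 ab /= (leq_trans (leq_subr _ _))// -ltnS.
rewrite mulnC GRing.mulrnA; exact: (subgroupMn (tower_subgroup tQ i) q Qd).
Qed.

(** By [layer_fact] the values on [filtration n] are fractions with denominator [S!], and their
    numerators are taken as digits of [u]. The explicit bound on [u] is what later makes the kernels
    of restriction enumerable. *)
Lemma represents_exist n i X : annihilator [set x | Q i x = Q i 0%R] X ->
  exists2 u, u < (layer n i)`! ^ layer n i & represents n (2 ^ i * (2 * u).+1) X.
Proof.
move=> Xi; set S := layer n i.
have vex a : exists2 v, v < S`! & forall x, filtration n x -> Q i x = a ->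
    character_fun X x = frac R v S`!.
  have [[x nx xa]|na] := pselect (exists2 x, filtration n x & Q i x = a); last first.
    by exists 0 => [|x nx xa]; [exact: fact_gt0|case: na; exists x].
  have [|v vS vE] := @circle_torsion R (character_fun X x) S`! (fact_gt0 _).
    by rewrite -(addfMn (@characterD _ _ X)); apply: Xi; exact: layer_fact.
  exists v => // y ny ya; rewrite -vE; apply/eqP; rewrite -GRing.subr_eq0.
  by rewrite -(addfB (@characterD _ _ X)) Xi//; apply: (tower_eq tQ i _ _).1;
    rewrite xa ya.
pose v a := projT1 (cid2 (vex a)).
have vS a : v a < S`! by rewrite /v; case: cid2.
have vE x : filtration n x -> character_fun X x = frac R (v (Q i x)) S`!.
  by move=> nx; rewrite /v; case: cid2 => w /= _; exact.
have [u uS uE] := @digits_exist S`! S v (fact_gt0 _) (fun x _ => vS x).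
exists u => // x nx; have [lE pE] := lev_pay i u.
rewrite /digit /den lE pE uE ifT ?vE//.
by apply: memn_lt; apply: (layer_mem n i x).2.
Qed.

(** Values are small on some level subgroup, hence zero there: every character factors through a
    level. *)
Lemma represents_ex n X : exists c, `[< represents n c X >].
Proof.
have [i iX] := tower_base tQ (character_near X).
have Xi : annihilator [set x | Q i x = Q i 0%R] X.
  by apply: character_small => //; exact: tower_subgroup.
by have [u _ Xu] := represents_exist n Xi; eexists; apply/asboolP; exact: Xu.
Qed.

Lemma represents_eq n c X Y : represents n c X ->
  represents n c Y <-> forall x, filtration n x ->
    character_fun X x = character_fun Y x.
Proof.
by move=> XE; split=> [YE x nx|XY x nx]; [rewrite XE ?YE|rewrite -XY ?XE].
Qed.

(** Tables of different levels are compared by reading each of them from codes of one deeper level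
    [j]; the sum of the levels is a simple choice of [j]. *)
Definition numer n a j x := digit n a (descend F j (j - lev a) x).

Lemma numerE n a j x : lev a <= j -> numer n a j (Q j x) = digit n a (Q (lev a) x).
Proof. by move=> aj; rewrite /numer descendE ?leq_subr// subKn. Qed.

Definition sum_level a b c := lev a + lev b + lev c.

(* [a + b = c] on [filtration n], with denominators cleared. The code [a] may belong to
   a larger [n'], so that taking [b] to be zero expresses restriction. *)
Definition sum_code n n' a b c :=
  bounded_all (layer n (sum_level a b c)) (fun x =>
    memn (layer n (sum_level a b c)) x ==>
   ((numer n' a (sum_level a b c) x * (den n b * den n c) +
     numer n b (sum_level a b c) x * (den n' a * den n c)) %%
      (den n' a * den n b * den n c) ==
    numer n c (sum_level a b c) x * (den n' a * den n b) %%
      (den n' a * den n b * den n c))).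

Lemma rec_sum_code n (f f' g h l : n.-tuple nat -> nat) : recursive f ->
  recursive f' -> recursive g -> recursive h -> recursive l ->
  recursive (fun t => sum_code (f t) (f' t) (g t) (h t) (l t) : nat).
Proof.
by move=> *; rewrite /sum_code /numer /sum_level; rec.
Qed.
#[local] Hint Extern 1 (recursive (fun _ => nat_of_bool (sum_code _ _ _ _ _))) =>
  apply: rec_sum_code : recursive.

Lemma sum_codeP n n' a b c X Y Z : n <= n' ->
  represents n' a X -> represents n b Y -> represents n c Z ->
  sum_code n n' a b c <-> forall x, filtration n x ->
    (character_fun X x + character_fun Y x)%R = character_fun Z x.
Proof.
move=> nn' Xa Yb Zc; set j := sum_level a b c.
have aj : lev a <= j by rewrite /j /sum_level -addnA leq_addr.
have bj : lev b <= j by rewrite /j /sum_level addnAC leq_addl.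
have cj : lev c <= j by rewrite /j /sum_level leq_addl.
pose A := den n' a; pose B := den n b; pose C := den n c.
have [A0 B0 C0] : [/\ 0 < A, 0 < B & 0 < C] by split; exact: den_gt0.
have ABC0 : 0 < A * B * C by rewrite !muln_gt0 A0 B0.
have E x : filtration n x ->
    ((numer n' a j (Q j x) * (B * C) + numer n b j (Q j x) * (A * C)) %%
      (A * B * C) == numer n c j (Q j x) * (A * B) %% (A * B * C)) <->
    (character_fun X x + character_fun Y x)%R = character_fun Z x.
  move=> nx; rewrite !numerE// Xa ?Yb ?Zc//; last exact: filtration_le nx.
  rewrite -(fracM R _ A (k := B * C)) ?muln_gt0 ?B0// -(fracM R _ B (k :=
    A * C)) ?muln_gt0 ?A0//.
  rewrite -(fracM R _ C (k := A * B)) ?muln_gt0 ?A0// -/A -/B -/C.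
  rewrite [B * (A * C)]mulnCA [C * (A * B)]mulnC -[A * B * C]mulnA -fracD.
  by rewrite frac_eq ?muln_gt0 ?A0 ?B0//; split=> /eqP.
split=> [/bounded_allP s x nx|s].
  have mx : memn (layer n j) (Q j x) by apply/layer_mem.
  by apply/E => //; have := s _ (memn_lt mx); rewrite mx.
apply/bounded_allP => d _; apply/implyP => /layerP[x nx <-].
by apply/E => //; exact: s.
Qed.

(** The same restriction is coded at many levels and with arbitrary digits outside the layer; taking
    the least code makes equal codes mean equal restrictions. *)
Definition dcode n X := ex_minn (represents_ex n X).

Lemma dcode_represents n X : represents n (dcode n X) X.
Proof. by rewrite /dcode; case: ex_minnP => c /asboolP. Qed.

Arguments dcode_represents : clear implicits.

Lemma dcode_min n X c : represents n c X -> dcode n X <= c.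
Proof. by rewrite /dcode; case: ex_minnP => d _ dmin ?; apply: dmin; apply/asboolP. Qed.

Lemma dcode_eq n X Y : dcode n X = dcode n Y <->
  forall x, filtration n x -> character_fun X x = character_fun Y x.
Proof.
split=> [XY x nx|XY].
  by rewrite (@dcode_represents n X)// XY -(@dcode_represents n Y).
apply/eqP; rewrite eqn_leq; apply/andP; split; apply: dcode_min.
  by apply: (represents_eq _ (dcode_represents n Y)).2 => x nx; rewrite XY.
exact: (represents_eq _ (dcode_represents n X)).2.
Qed.

(** Both sides are least elements of the same set; so a decidable test for representing [X] is
    enough to compute its canonical code. *)
Lemma search_dcode n X (g : bool) (P : pred nat) : g ->
  (forall c, P c <-> represents n c X) -> search g P = dcode n X.
Proof.
move=> gT PE; have [|/PE + smin] := @searchP g P _ gT.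
  by move=> _; exists (dcode n X); apply/PE; exact: dcode_represents.
move=> Xs; apply/eqP; rewrite eqn_leq dcode_min// andbT; apply: smin.
by apply/PE; exact: dcode_represents.
Qed.

Lemma sum_represents n n' a b X Y W c : n <= n' ->
  represents n' a X -> represents n b Y ->
  (forall x, filtration n x -> (character_fun X x + character_fun Y x)%R =
    character_fun W x) ->
  valid n c && sum_code n n' a b c <-> represents n c W.
Proof.
move=> nn' Xa Yb XYW; split=> [/andP[/valid_represents[Z Zc]]|Wc].
  move=> /(sum_codeP nn' Xa Yb Zc) XYZ.
  by apply: (represents_eq _ Zc).2 => x nx; rewrite -XYZ// XYW.
by rewrite (represents_valid Wc) /=; apply/(sum_codeP nn' Xa Yb Wc).
Qed.

Lemma opp_represents n a X o c : represents n a X -> represents n o 0%R ->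
  valid n c && sum_code n n a c o <-> represents n c (- X)%R.
Proof.
move=> Xa o0; split=> [/andP[/valid_represents[Z Zc]]|Wc].
  move=> /(sum_codeP (leqnn n) Xa Zc o0) XZ.
  apply: (represents_eq _ Zc).2 => x nx; have /eqP := XZ _ nx.
  by rewrite character0E GRing.addrC GRing.addr_eq0 => /eqP ->;
    rewrite (addfN (eval_morph x)).
rewrite (represents_valid Wc) /=; apply/(sum_codeP (leqnn n) Xa Wc o0) => x nx.
by rewrite (addfN (eval_morph x)) GRing.addrN.
Qed.

(** Zero is characterized by [c + c = c], a test that presupposes no code of zero. *)
Lemma zero_represents n c : valid n c && sum_code n n c c c <-> represents n c 0%R.
Proof.
split=> [/andP[/valid_represents[Z Zc]]|Wc].
  move=> /(sum_codeP (leqnn n) Zc Zc Zc) ZZ.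
  apply: (represents_eq _ Zc).2 => x nx; have /eqP := ZZ _ nx.
  by rewrite -GRing.subr_eq0 GRing.addrK => /eqP.
rewrite (represents_valid Wc) /=; apply/(sum_codeP (leqnn n) Wc Wc Wc) => x nx.
by rewrite character0E GRing.addr0.
Qed.

Definition zero_code n := search true (fun c => valid n c && sum_code n n c c c).

Lemma zero_codeE n : zero_code n = dcode n 0%R.
Proof. by apply: search_dcode => // c; exact: zero_represents. Qed.

Lemma rec_zero_code n (f : n.-tuple nat -> nat) : recursive f ->
  recursive (fun t => zero_code (f t)).
Proof.
move=> rf; refine (@rec_search n (fun=> true)
  (fun c (t : n.-tuple nat) => valid (f t) c && sum_code (f t) (f t) c c c) _ _ _).
- by move=> t _; exists (dcode (f t) 0%R); apply/zero_represents;
  exact: dcode_represents.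
- exact: rec_const.
- by rec.
Qed.
#[local] Hint Extern 1 (recursive (fun _ => zero_code _)) =>
  apply: rec_zero_code : recursive.

(** A canonical code is a valid number with no smaller valid equivalent; [d] and [c] are compared
    through [d + 0 = c]. *)
Definition range_code n c := valid n c && bounded_all c (fun d =>
  ~~ (valid n d && sum_code n n d (zero_code n) c)).

Lemma zero_code_represents n : represents n (zero_code n) 0%R.
Proof. by rewrite zero_codeE; exact: dcode_represents. Qed.

Arguments zero_code_represents : clear implicits.

Lemma range_codeP n c : range_code n c <-> range (dcode n) c.
Proof.
have o0 := zero_code_represents n; split=> [/andP[/valid_represents[X Xc]
  /bounded_allP cmin]|].
  exists X => //; apply/eqP; rewrite eqn_leq dcode_min// leqNgt; apply/negP => lt.
  have dX := dcode_represents n X; move/negP: (cmin _ lt); apply.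
  rewrite (represents_valid dX) /=; apply/(sum_codeP (leqnn n) dX o0 Xc) => x _.
  by rewrite GRing.addr0.
move=> [X _ <-]; have dX := dcode_represents n X.
rewrite /range_code (represents_valid dX) /=; apply/bounded_allP => d; rewrite ltnNge.
apply: contraNN => /andP[/valid_represents[Z Zd] /(sum_codeP (leqnn n) Zd o0 dX) ZX].
apply: dcode_min; apply: (represents_eq _ Zd).2 => x nx.
by rewrite -ZX// GRing.addr0.
Qed.

Lemma rec_range_code n (f g : n.-tuple nat -> nat) : recursive f -> recursive g ->
  recursive (fun t => range_code (f t) (g t) : nat).
Proof.
move=> rf rg; by rewrite /range_code; rec.
Qed.
#[local] Hint Extern 1 (recursive (fun _ => nat_of_bool (range_code _ _))) =>
  apply: rec_range_code : recursive.

Definition kernel_test n x :=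
  range_code n.+1 x && sum_code n n.+1 x (zero_code n) (zero_code n).

Lemma rec_kernel_test n (f g : n.-tuple nat -> nat) : recursive f -> recursive g ->
  recursive (fun t => kernel_test (f t) (g t) : nat).
Proof.
by move=> rf rg; rewrite /kernel_test; rec.
Qed.
#[local] Hint Extern 1 (recursive (fun _ => nat_of_bool (kernel_test _ _))) =>
  apply: rec_kernel_test : recursive.

Lemma kernel_testP n x : kernel_test n x <->
  exists2 X, dcode n X = dcode n 0%R & dcode n.+1 X = x.
Proof.
have o0 := zero_code_represents n; split=> [/andP[/range_codeP[X _ <-]]|[X X0 <-]].
  move=> /(sum_codeP (leqnSn n) (dcode_represents n.+1 X) o0 o0) X0.
  by exists X => //; apply/dcode_eq => x0 nx; rewrite -X0// GRing.addr0.
apply/andP; split; first by apply/range_codeP; exists X.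
apply/(sum_codeP (leqnSn n) (dcode_represents n.+1 X) o0 o0) => x0 nx.
by move/dcode_eq: X0 => /(_ _ nx) ->; rewrite GRing.addr0.
Qed.

(** A character trivial on [filtration n] kills the kernel of level 0, which lies inside. On
    [filtration n.+1] it therefore has a code [2 ^ 0 * (2 * u).+1] with [u] bounded as in
    [represents_exist]. *)
Definition kernel_bound n := (2 * ((layer n.+1 0)`! ^ layer n.+1 0)).+1.

Lemma kernel_test_bound n x : kernel_test n x -> x < kernel_bound n.
Proof.
move=> /kernel_testP[X X0 <-].
have [|u uS Xu] := @represents_exist n.+1 0 X.
  move=> y y0; move/dcode_eq: X0 => /(_ y) ->//; exact: filtration_ker.
apply: leq_ltn_trans (dcode_min Xu) _.
by rewrite expn0 mul1n /kernel_bound ltnS ltn_mul2l.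
Qed.

Definition kernel_index n := search true (fun u =>
  bounded_all (kernel_bound n) (fun x => (memn u x ==> kernel_test n x) &&
    (kernel_test n x ==> memn u x)) &&
  bounded_all u (fun x => memn u x ==> (x < kernel_bound n))).

Lemma kernel_index_exist n : exists u,
  bounded_all (kernel_bound n) (fun x => (memn u x ==> kernel_test n x) &&
    (kernel_test n x ==> memn u x)) &&
  bounded_all u (fun x => memn u x ==> (x < kernel_bound n)).
Proof.
have [u uE] := memn_exist [seq x <- iota 0 (kernel_bound n) | kernel_test n x].
exists u; apply/andP; split; apply/bounded_allP => x xb;
  rewrite uE mem_filter mem_iota /=.
  by rewrite add0n xb andbT; case: kernel_test.
by apply/implyP => /andP[].
Qed.

Lemma kernel_indexP n x : memn (kernel_index n) x <-> kernel_test n x.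
Proof.
have [/andP[/bounded_allP u1 /bounded_allP u2] _] := @searchP true _ (fun _ =>
  kernel_index_exist n) isT.
split=> [ux|xk].
  have xb := implyP (u2 _ (memn_lt ux)) ux.
  by have /andP[/implyP/(_ ux)] := u1 _ xb.
by have /andP[_ /implyP/(_ xk)] := u1 _ (kernel_test_bound xk).
Qed.

Lemma kernel_index_computable : computable1 kernel_index.
Proof.
apply: rec_computable1; refine (@rec_search 1 (fun=> true)
  (fun u (t : 1.-tuple nat) =>
    bounded_all (kernel_bound (thead t)) (fun x =>
      (memn u x ==> kernel_test (thead t) x) &&
      (kernel_test (thead t) x ==> memn u x)) &&
    bounded_all u (fun x => memn u x ==> (x < kernel_bound (thead t)))) _ _ _).
- by move=> t _; exact: kernel_index_exist.
- exact: rec_const.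
- by rewrite /kernel_bound; rec.
Qed.

(** The filtration is increasing and exhausts [H], and each of its members is stable under the open
    kernel of level 0. *)
Lemma filtration_cover (K : set H) : compact K -> exists n, K `<=` filtration n.
Proof.
move=> /compact_near_coveringP/(_ nat \oo (fun n x => filtration n x)).
have near x : K x -> \forall x' \near x & i \near \oo, filtration i x'.
  move=> Kx; exists ([set y | Q 0 (y - x)%R = Q 0 0%R], [set n | (Q 0 x).+1 <= n]).
    split; last by exists (Q 0 x).+1.
    by apply: (nbhs_translate [set y | Q 0 y = Q 0 0%R] x).1; exact: tower_nbhs.
  move=> [y n] /= [yx xn]; apply: (filtration_le xn).
  have xy : Q 0 x = Q 0 y by apply/esym; apply: (tower_eq tQ 0 _ _).2.
  by apply: level0_congr xy _; exact: filtration_exhaust.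
by move=> /(_ _ near)[n _ nK]; exists n; exact: (nK n (leqnn n)).
Qed.

Lemma dual_tower : complete_tower dcode.
Proof.
have eq0 n X : dcode n X = dcode n 0%R <-> annihilator (filtration n) X.
  by rewrite dcode_eq.
split.
- exists (fun n a b => search (valid n a && valid n b)
      (fun c => valid n c && sum_code n n a b c)).
    apply: rec_computable3; refine (@rec_search 3 (fun t : 3.-tuple nat =>
        valid (thead t) (thead (behead_tuple t)) &&
        valid (thead t) (thead (behead_tuple (behead_tuple t))))
      (fun c (t : 3.-tuple nat) => valid (thead t) c &&
        sum_code (thead t) (thead t) (thead (behead_tuple t))
          (thead (behead_tuple (behead_tuple t))) c) _ _ _).
    + move=> t /andP[/valid_represents[X Xa] /valid_represents[Y Yb]].
      exists (dcode (thead t) (X + Y)%R).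
      apply: (sum_represents (W := (X + Y)%R) _ (leqnn _) Xa Yb _).2 => //.
      exact: dcode_represents.
    + by rec.
    + by rec.
  move=> n X Y; have dX := dcode_represents n X; have dY := dcode_represents n Y.
  apply: search_dcode; first by rewrite (represents_valid dX) (represents_valid dY).
  by move=> c; apply: (sum_represents c (leqnn _) dX dY).
- exists (fun n a => search (valid n a) (fun c => valid n c &&
  sum_code n n a c (zero_code n))).
    apply: rec_computable2; refine (@rec_search 2 (fun t : 2.-tuple nat =>
        valid (thead t) (thead (behead_tuple t)))
      (fun c (t : 2.-tuple nat) => valid (thead t) c &&
        sum_code (thead t) (thead t) (thead (behead_tuple t)) c (zero_code (thead
          t))) _ _ _).
    + move=> t /valid_represents[X Xa]; exists (dcode (thead t) (- X)%R).
      by apply/(opp_represents _ Xa (zero_code_represents _)); exact: dcode_represents.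
    + by rec.
    + by rec.
  move=> n X; have dX := dcode_represents n X.
  apply: search_dcode; first exact: (represents_valid dX).
  by move=> c; apply: (opp_represents c dX (zero_code_represents n)).
- apply: rec_computable1; apply: (@rec_ext _ (fun t : 1.-tuple nat =>
  zero_code (thead t))).
    by move=> t; rewrite zero_codeE.
  by rec.
- apply: rec_computable2; apply: (@rec_ext _ (fun t : 2.-tuple nat =>
    range_code (thead t) (thead (behead_tuple t)) : nat)).
    move=> t; congr nat_of_bool; apply/idP/asboolP => /range_codeP //.
  by rec.
- exists (fun n a => search (valid n.+1 a)
      (fun c => valid n c && sum_code n n.+1 a (zero_code n) c)).
    apply: rec_computable2; refine (@rec_search 2 (fun t : 2.-tuple nat =>
        valid (thead t).+1 (thead (behead_tuple t)))
      (fun c (t : 2.-tuple nat) => valid (thead t) c &&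
        sum_code (thead t) (thead t).+1 (thead (behead_tuple t)) (zero_code (thead
          t)) c) _ _ _).
    + move=> t /valid_represents[X Xa]; exists (dcode (thead t) X).
      apply: (sum_represents (W := X) _ (leqnSn _) Xa (zero_code_represents _) _).2.
        by move=> x _; rewrite GRing.addr0.
      exact: dcode_represents.
    + by rec.
    + by rec.
  move=> n X; have dX := dcode_represents n.+1 X.
  apply: search_dcode; first exact: (represents_valid dX).
  move=> c; apply: (sum_represents c (leqnSn n) dX (zero_code_represents n)) => x _.
  by rewrite GRing.addr0.
- exists kernel_index; first exact: kernel_index_computable.
  move=> n; apply/seteqP; split=> x.
    by move=> /kernel_indexP/kernel_testP[X X0 <-]; exists X.
  by move=> [X X0 <-]; apply/kernel_indexP/kernel_testP; exists X.
- move=> n; have := annihilator_nbhs R (filtration_subgroup n) (@filtration_compact n).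
  by apply: filterS => X /eq0.
- move=> N /nbhs_dual[K /filtration_cover[n Kn] KN]; exists n => X /eq0 Xn.
  by apply: KN => x /Kn; exact: Xn.
- move=> X XE.
  have XS n x : filtration n x -> character_fun (X n.+1) x = character_fun (X n) x.
    by move: (XE n) => /dcode_eq; exact.
  have Xle m n x : m <= n -> filtration m x ->
    character_fun (X n) x = character_fun (X m) x.
    move=> /subnKC <-; elim: (n - m) => [|d IH] mx; first by rewrite addn0.
    rewrite addnS XS ?IH//; apply: filtration_le mx; exact: leq_addr.
  (* The stage [(Q 0 x).+1] is one whose filtration contains [x]; by compatibility any other such
     stage gives the same value. *)
  pose g x := character_fun (X (Q 0 x).+1) x.
  have gE n x : filtration n x -> g x = character_fun (X n) x.
    move=> nx; have [le|le] := leqP n (Q 0 x).+1; first exact: Xle.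
    by apply/esym; apply: Xle; [exact: ltnW|exact: filtration_exhaust].
  have gD : {morph g : x y / (x + y)%R}.
    move=> x y; pose n := (Q 0 x).+1 + (Q 0 y).+1.
    have nx : filtration n x by apply: filtration_le (filtration_exhaust x);
      exact: leq_addr.
    have ny : filtration n y by apply: filtration_le (filtration_exhaust y);
      exact: leq_addl.
    rewrite !(gE n)//; first exact: characterD.
    by apply: subgroupD => //; exact: filtration_subgroup.
  (* The neighbourhood of 0 given by level 0 lies in [filtration 0], where [g] is the continuous
     character [X 0]. *)
  have gc : continuous g.
    apply: morph_continuous => // U nU.
    have nX : nbhs (0%R : H) [set x | U (character_fun (X 0) x)].
      apply: (@character_continuous R H (X 0) 0%R).
      by rewrite (addf0 (@characterD _ _ (X 0))).
    apply: filterS (filterI (tower_nbhs tQ 0) nX) => x [x0 Ux].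
    by rewrite /= (gE 0)//; exact: filtration_ker.
  have [Y YE] := character_exists gc gD; exists Y => n.
  by apply/dcode_eq => x nx; rewrite YE (gE n).
- move=> X X0; apply: character_fun_inj; apply/funext => x.
  by have /eq0 := X0 (Q 0 x).+1; apply; exact: filtration_exhaust.
Qed.

End character_codes.

End tower_finite.

(** * Passage to the dual, and the equivalence *)

Theorem dual_presentation (R : realType) (H : topologicalZmodType) :
  totally_disconnected [set: pontryagin_dual R H] ->
  has_computable_tdlc_presentation H ->
  has_computable_tdlc_presentation (pontryagin_dual R H).
Proof.
move=> td /presentation_tower[Q tQ].
have [mul mul_c mulE] := tower_mul tQ.
have [F F_c FE] := tower_map tQ.
have [k k_c kE] := tower_ker tQ.
have tors x : exists2 m, 0 < m & Q 0 (x *+ m)%R = Q 0 0%R.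
  exact: (totally_disconnected_dual_torsion td (tower_subgroup tQ 0) (tower_nbhs tQ 0)).
apply: complete_tower_presentation.
exact: (dual_tower tQ mul_c mulE F_c FE k_c kE tors R).
Qed.

Lemma homeomorphism_totally_disconnected (S T : topologicalType) (f : S -> T) :
  homeomorphism f -> totally_disconnected [set: S] -> totally_disconnected [set: T].
Proof.
move=> [g [_ gK _ g_cont]] td y _; apply/seteqP; split=> [z|_ ->]; last first.
  exact: connected_component_refl.
move=> [C [Cy _ conC] Cz].
have : connected_component [set: S] (g y) (g z).
  apply: (@connected_component_max _ _ (g @` C)) => //.
  by apply: connected_continuous_connected => //; exact: continuous_subspaceT.
by rewrite td// => gzy; rewrite /= -(gK z) gzy gK.
Qed.

Theorem theorem1p3 (R : realType) (G : topologicalZmodType)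
    (G_polish : polish R G)
    (G_td : totally_disconnected [set: G])
    (G_lc : locally_compact [set: G])
    (dual_td : totally_disconnected [set: pontryagin_dual R G])
    (dual_lc : locally_compact [set: pontryagin_dual R G]) :
  has_computable_tdlc_presentation G <->
  has_computable_tdlc_presentation (pontryagin_dual R G).
Proof.
split; first exact: dual_presentation.
have [e e_homeo eD] := biduality G_td G_lc dual_td.
(* Applied to the dual of [G], the torsion argument requires the bidual to be totally disconnected;
   this is inherited from [G]. *)
have bidual_td := homeomorphism_totally_disconnected e_homeo G_td.
move=> /(dual_presentation bidual_td)/presentation_tower[Q tQ].
exact: complete_tower_presentation (complete_tower_comp e_homeo eD tQ).
Qed.
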